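(* Let $\mathbb{D}\in\{\mathbb{R},\mathbb{C},\mathbb{H}\}$, let $p,q\in\mathbb{N}$ with $p+q=n$, and let $J=\begin{pmatrix}\mathrm{Id}_p&0\\0&-\mathrm{Id}_q\end{pmatrix}$. There is a one-to-one correspondence between the set of $J$-Kubo-Ando means on $\mathscr{P}_J$ and the set of normalized operator monotone functions $f:(0,\infty)\to(0,\infty)$, $f(1)=1$. More precisely, if $\sigma_J$ is a $J$-Kubo-Ando mean on $\mathscr{P}_J$ and $f$ is the representing function of the corresponding Kubo-Ando mean $\sigma$ on $\mathscr{P}$ (the one given by $X\,\sigma\,Y=J\big((JX)\,\sigma_J\,(JY)\big)$ for $X,Y\in\mathscr{P}$), then $$A\,\sigma_J\,B=A_J^{\frac12}\bullet f_J\!\left(A_J^{-\frac12}\bullet B\bullet A_J^{-\frac12}\right)\bullet A_J^{\frac12}\qquad\text{for all }A,B\in\mathscr{P}_J,\qquad(\ast)$$ where $f_J:\mathscr{P}_J\to\mathscr{P}_J$ is defined by $f_J(X):=J\,f(JX)$. Conversely, every normalized operator monotone function $f:(0,\infty)\to(0,\infty)$ defines a unique $J$-Kubo-Ando mean $\sigma_J$ by the formula $(\ast)$.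
   Context: $\mathrm{Mat}_n(\mathbb{D})$ is the set of $n\times n$ matrices over $\mathbb{D}$ and $\mathrm{GL}_n(\mathbb{D})$ its invertible elements. For $X\in\mathrm{Mat}_n(\mathbb{D})$: $X^*=\overline{X}^{t}$ (conjugate transpose, quaternionic conjugation if $\mathbb{D}=\mathbb{H}$) and $X^\sharp=JX^*J$. Set $\mathfrak{p}=\{X\in\mathrm{Mat}_n(\mathbb{D}):X=X^*\}$, $\mathscr{P}=\{X\in\mathfrak{p}:X>0\}$ (positive definite; for $\mathbb{D}=\mathbb{H}$, all right eigenvalues positive), $\mathfrak{p}_J=\{X\in\mathrm{Mat}_n(\mathbb{D}):X=X^\sharp\}$, $\mathscr{P}_J=\{X\in\mathfrak{p}_J: JX>0\}$. The map $X\mapsto JX$ is a bijection from $\mathscr{P}_J$ onto $\mathscr{P}$. Orders: on $\mathscr{P}$, $A\preceq B$ if $B-A$ is positive semi-definite; on $\mathscr{P}_J$, $A\preceq_J B$ if $JA\preceq JB$. A Kubo-Ando mean on $\mathscr{P}$ is a continuous map $\sigma:\mathscr{P}\times\mathscr{P}\to\mathscr{P}$ such that (1) $A\preceq B$, $C\preceq D$ imply $A\,\sigma\,C\preceq B\,\sigma\,D$; (2) $g(A\,\sigma\,B)g^*=(gAg^* )\,\sigma\,(gBg^* )$ for all $g\in\mathrm{GL}_n(\mathbb{D})$, $A,B\in\mathscr{P}$; (3) $\mathrm{Id}_n\,\sigma\,\mathrm{Id}_n=\mathrm{Id}_n$. Its representing function is the operator monotone function $f:(0,\infty)\to(0,\infty)$,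 $f(1)=1$, such that $A\,\sigma\,B=A^{1/2}f(A^{-1/2}BA^{-1/2})A^{1/2}$ for all $A,B\in\mathscr{P}$ (functional calculus). A $J$-Kubo-Ando mean on $\mathscr{P}_J$ is a continuous map $\sigma_J:\mathscr{P}_J\times\mathscr{P}_J\to\mathscr{P}_J$ such that (1) $A\preceq_J B$, $C\preceq_J D$ imply $A\,\sigma_J\,C\preceq_J B\,\sigma_J\,D$; (2) $g^\sharp(A\,\sigma_J\,B)g=(g^\sharp Ag)\,\sigma_J\,(g^\sharp Bg)$ for all $g\in\mathrm{GL}_n(\mathbb{D})$, $A,B\in\mathscr{P}_J$; (3) $J\,\sigma_J\,J=J$. For $A,B\in\mathrm{Mat}_n(\mathbb{D})$, $A\bullet B=AJB$. For $X\in\mathscr{P}_J$ and $t\in\mathbb{R}$, $X_J^t=J(JX)^t$, where $(JX)^t$ is the usual real power of the positive definite matrix $JX$. In $f_J(X)=Jf(JX)$, $f(JX)$ is given by the functional calculus. Operator monotone has its standard meaning: for every $m\ge1$ and all positive definite complex Hermitian $m\times m$ matrices $A,B$ with $B-A$ positive semi-definite, $f(B)-f(A)$ is positive semi-definite.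
   Formalization: The correspondence is proved for n≥1 and onto those J-Kubo-Ando means whose associated mean has an operator monotone representing function; for fixed n not all do (n=1, 𝔻=ℝ, J=1: max(a,b) gives f(t)=max(1,t), not operator monotone). *)

(* Defs.v *)
From HB Require Import structures.
From mathcomp Require Import all_boot all_order all_algebra.
From mathcomp Require Import all_classical all_reals all_analysis.
From mathcomp Require Import complex ring.

Set Implicit Arguments.
Unset Strict Implicit.
Unset Printing Implicit Defensive.

Import Order.TTheory GRing.Theory Num.Theory.
Import numFieldNormedType.Exports.

Local Open Scope classical_set_scope.
Local Open Scope ring_scope.

HB.mixin Record isStarRing (R : realType) D
    of GRing.NzRing D & Topological D := {
  conjs : D -> D;
  reals : R -> D;
  conjsK : involutive conjs;
  conjsD : {morph conjs : x y / x + y};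
  conjsM : forall x y, conjs (x * y) = conjs y * conjs x;
  reals1 : reals 1 = 1;
  realsD : {morph reals : r s / r + s};
  realsM : {morph reals : r s / r * s};
  reals_comm : forall r x, reals r * x = x * reals r;
  conjs_real : forall r, conjs (reals r) = reals r
}.

#[short(type="starRingType")]
HB.structure Definition StarRing (R : realType) :=
  {D of GRing.NzRing D & Topological D & isStarRing R D}.

HB.instance Definition _ (R : realType) :=
  isStarRing.Build R R^o
    (conjs := id) (reals := id)
    (fun=> erefl) (fun _ _ => erefl) (fun x y => mulrC x y)
    erefl (fun _ _ => erefl) (fun _ _ => erefl) (fun r x => mulrC r x)
    (fun=> erefl).

HB.instance Definition _ (R : realType) :=
  Topological.copy R[i] (R[i] : numFieldType)^o.

Section complex_star.
Variable R : realType.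
Let conjc (z : R[i]) : R[i] := z^*%C.
Let realc (r : R) : R[i] := r%:C%C.

Fact conjc_inv : involutive conjc.
Proof. by move=> [a b]; rewrite /conjc /= opprK. Qed.
Fact conjc_add : {morph conjc : x y / x + y}.
Proof. by move=> x y; rewrite /conjc rmorphD. Qed.
Fact conjc_mul x y : conjc (x * y) = conjc y * conjc x.
Proof. by rewrite /conjc rmorphM mulrC. Qed.
Fact realc_one : realc 1 = 1. Proof. by []. Qed.
Fact realc_add : {morph realc : r s / r + s}.
Proof. by move=> r s; rewrite /realc rmorphD. Qed.
Fact realc_mul : {morph realc : r s / r * s}.
Proof. by move=> r s; rewrite /realc rmorphM. Qed.
Fact realc_comm r x : realc r * x = x * realc r. Proof. exact: mulrC. Qed.
Fact conjc_realc r : conjc (realc r) = realc r.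
Proof. by rewrite /conjc /realc /= oppr0. Qed.

HB.instance Definition _ := isStarRing.Build R R[i] conjc_inv conjc_add
  conjc_mul realc_one realc_add realc_mul realc_comm conjc_realc.
End complex_star.

(* [Quat a b c d] is a + b i + c j + d k. *)
Record quaternion (R : Type) := Quat { qr : R; qi : R; qj : R; qk : R }.

Section quaternion_choice.
Variable T : Type.
Definition seq_of_quat (x : quaternion T) :=
  let: Quat a b c d := x in [:: a; b; c; d].
Definition quat_of_seq (s : seq T) :=
  if s is [:: a; b; c; d] then Some (Quat a b c d) else None.
Fact seq_of_quatK : pcancel seq_of_quat quat_of_seq. Proof. by case. Qed.
End quaternion_choice.

HB.instance Definition _ (T : choiceType) := Choice.copy (quaternion T)
  (pcan_type (@seq_of_quatK T)).

Section quaternion_ring.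
Variable R : realType.
Local Notation H := (quaternion R).

Definition zeroq : H := Quat 0 0 0 0.
Definition oneq : H := Quat 1 0 0 0.
Definition oppq (x : H) : H :=
  let: Quat a b c d := x in Quat (- a) (- b) (- c) (- d).
Definition addq (x y : H) : H :=
  let: Quat a b c d := x in let: Quat a' b' c' d' := y in
  Quat (a + a') (b + b') (c + c') (d + d').
Definition mulq (x y : H) : H :=
  let: Quat a b c d := x in let: Quat a' b' c' d' := y in
  Quat (a * a' - b * b' - c * c' - d * d')
       (a * b' + b * a' + c * d' - d * c')
       (a * c' - b * d' + c * a' + d * b')
       (a * d' + b * c' - c * b' + d * a').
Definition conjq (x : H) : H :=
  let: Quat a b c d := x in Quat a (- b) (- c) (- d).
Definition realq (r : R) : H := Quat r 0 0 0.
Definition coordq (x : H) : R * R * R * R :=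
  let: Quat a b c d := x in (a, b, c, d).

Fact addqA : associative addq.
Proof. by move=> [? ? ? ?] [? ? ? ?] [? ? ? ?]; rewrite /= !addrA. Qed.
Fact addqC : commutative addq.
Proof. by move=> [? ? ? ?] [? ? ? ?]; congr Quat; rewrite addrC. Qed.
Fact add0q : left_id zeroq addq.
Proof. by move=> [? ? ? ?]; rewrite /= !add0r. Qed.
Fact addNq : left_inverse zeroq oppq addq.
Proof. by move=> [? ? ? ?]; rewrite /= !addNr. Qed.

HB.instance Definition _ := GRing.isZmodule.Build H addqA addqC add0q addNq.

Fact mulqA : associative mulq.
Proof. by move=> [? ? ? ?] [? ? ? ?] [? ? ? ?]; congr Quat; ring. Qed.
Fact mul1q : left_id oneq mulq.
Proof. by move=> [? ? ? ?]; congr Quat; ring. Qed.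
Fact mulq1 : right_id oneq mulq.
Proof. by move=> [? ? ? ?]; congr Quat; ring. Qed.
Fact mulqDl : left_distributive mulq addq.
Proof. by move=> [? ? ? ?] [? ? ? ?] [? ? ? ?]; congr Quat; ring. Qed.
Fact mulqDr : right_distributive mulq addq.
Proof. by move=> [? ? ? ?] [? ? ? ?] [? ? ? ?]; congr Quat; ring. Qed.
Fact oneq_neq0 : oneq != zeroq.
Proof. by apply/eqP => -[] /eqP; rewrite oner_eq0. Qed.

HB.instance Definition _ := GRing.Zmodule_isNzRing.Build H
  mulqA mul1q mulq1 mulqDl mulqDr oneq_neq0.

HB.instance Definition _ := Topological.copy H (initial_topology coordq).

Fact conjq_inv : involutive conjq.
Proof. by move=> [? ? ? ?]; rewrite /= !opprK. Qed.
Fact conjq_add : {morph conjq : x y / x + y}.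
Proof. by move=> [? ? ? ?] [? ? ? ?]; congr Quat; ring. Qed.
Fact conjq_mul (x y : H) : conjq (x * y) = conjq y * conjq x.
Proof. by case: x y => [? ? ? ?] [? ? ? ?]; congr Quat; ring. Qed.
Fact realq_one : realq 1 = 1. Proof. by []. Qed.
Fact realq_add : {morph realq : r s / r + s}.
Proof. by move=> r s; congr Quat; ring. Qed.
Fact realq_mul : {morph realq : r s / r * s}.
Proof. by move=> r s; congr Quat; ring. Qed.
Fact realq_comm r (x : H) : realq r * x = x * realq r.
Proof. by case: x => [? ? ? ?]; congr Quat; ring. Qed.
Fact conjq_realq r : conjq (realq r) = realq r.
Proof. by congr Quat; ring. Qed.

HB.instance Definition _ := isStarRing.Build R H conjq_inv conjq_add
  conjq_mul realq_one realq_add realq_mul realq_comm conjq_realq.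
End quaternion_ring.

Variant scalar_kind := RealScalars | ComplexScalars | QuaternionScalars.

Definition scalar (R : realType) (k : scalar_kind) : starRingType R :=
  match k with
  | RealScalars => R^o : starRingType R
  | ComplexScalars => R[i] : starRingType R
  | QuaternionScalars => quaternion R : starRingType R
  end.

Definition ctrmx (R : realType) (D : starRingType R) m n
  (X : 'M[D]_(m, n)) : 'M[D]_(n, m) := map_mx (@conjs R D) X^T.

Section ctrmx_theory.
Variables (R : realType) (D : starRingType R).

Fact conjs0 : @conjs R D 0 = 0.
Proof. by apply: (addrI (conjs 0)); rewrite -conjsD !addr0. Qed.
Fact conjs1 : @conjs R D 1 = 1.
Proof. by rewrite -(reals1 (R := R)) conjs_real. Qed.
Fact conjsN (x : D) : conjs (- x) = - conjs x.
Proof. by apply: (addrI (conjs x)); rewrite -conjsD !subrr conjs0. Qed.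

Fact ctrmx_mul m n p (A : 'M[D]_(m, n)) (B : 'M[D]_(n, p)) :
  ctrmx (A *m B) = ctrmx B *m ctrmx A.
Proof.
apply/matrixP => i j; rewrite !mxE (big_morph _ (@conjsD R D) conjs0).
by apply: eq_bigr => l _; rewrite !mxE conjsM.
Qed.
End ctrmx_theory.

Definition invertible_mx (D : nzRingType) n (g : 'M[D]_n) : Prop :=
  exists h, g *m h = 1%:M /\ h *m g = 1%:M.

Section positivity.
Variables (R : realType) (k : scalar_kind) (n : nat).
Local Notation D := (scalar R k).
Implicit Type X : 'M[D]_n.

Definition hermitian_mx X : Prop := X = ctrmx X.

Definition right_eigenvalue X (l : D) : Prop :=
  exists2 v : 'cV[D]_n, v != 0 & X *m v = v *m l%:M.

(* The quadratic form [v^* X v], resp. the right eigenvalues over the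
   quaternions, are required to take their values in S, the half-line of
   positive or of nonnegative reals. *)
Definition definite_mx (S : set R) X : Prop :=
  hermitian_mx X /\
  match k with
  | QuaternionScalars =>
      forall l : D, right_eigenvalue X l -> (@reals R D @` S) l
  | _ =>
      forall v : 'cV[D]_n, v != 0 ->
        (@reals R D @` S) ((ctrmx v *m X *m v) 0 0)
  end.

Definition posdef_mx : set 'M[D]_n := definite_mx [set r | 0 < r].
Definition possemidef_mx : set 'M[D]_n := definite_mx [set r | 0 <= r].

(* The set below has exactly one element when X is positive definite: f(X) is
   computed in any unitary diagonalization of X. *)
Definition fun_calc (f : {posnum R} -> {posnum R}) X : 'M[D]_n :=
  xget 0 [set Y | exists (U : 'M[D]_n) (l : 'I_n -> {posnum R}),
    [/\ U *m ctrmx U = 1%:M, ctrmx U *m U = 1%:M,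
        X = U *m diag_mx (\row_i reals (l i)%:num) *m ctrmx U &
        Y = U *m diag_mx (\row_i reals (f (l i))%:num) *m ctrmx U]].

Definition powR_mx (t : R) X : 'M[D]_n :=
  fun_calc (fun x => (x%:num `^ t)%:pos) X.

End positivity.

Definition operator_monotone (R : realType)
    (f : {posnum R} -> {posnum R}) : Prop :=
  forall (m : nat) (A B : 'M[scalar R ComplexScalars]_m), (0 < m)%N ->
    posdef_mx A -> posdef_mx B -> possemidef_mx (B - A) ->
    possemidef_mx (fun_calc f B - fun_calc f A).

Definition normalized_operator_monotone (R : realType) :
    set ({posnum R} -> {posnum R}) :=
  [set f | f 1%:pos = 1%:pos /\ operator_monotone f].

Section kubo_ando.
Variables (R : realType) (k : scalar_kind) (n : nat).
Local Notation D := (scalar R k).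
Local Notation P := (@posdef_mx R k n).

Definition loewner_le (A B : 'M[D]_n) : Prop := possemidef_mx (B - A).

(* In the third clause [gA] and [gB] name the elements [g A g^*] and [g B g^*]
   of P; in the fourth, [I] names the identity matrix as an element of P. *)
Definition kubo_ando_mean (s : P -> P -> P) : Prop :=
  [/\ continuous (fun AB : P * P => s AB.1 AB.2),
      forall A B C E : P,
        loewner_le (set_val A) (set_val B) ->
        loewner_le (set_val C) (set_val E) ->
        loewner_le (set_val (s A C)) (set_val (s B E)),
      forall (g : 'M[D]_n) (A B gA gB : P), invertible_mx g ->
        set_val gA = g *m set_val A *m ctrmx g ->
        set_val gB = g *m set_val B *m ctrmx g ->
        g *m set_val (s A B) *m ctrmx g = set_val (s gA gB) &
      forall I : P, set_val I = 1%:M -> s I I = I].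

Definition representing_function (s : P -> P -> P)
    (f : {posnum R} -> {posnum R}) : Prop :=
  normalized_operator_monotone f /\
  forall A B : P,
    let rA := powR_mx 2^-1 (set_val A) in
    let rA' := powR_mx (- 2^-1) (set_val A) in
    set_val (s A B) = rA *m fun_calc f (rA' *m set_val B *m rA') *m rA.

End kubo_ando.

Section J_kubo_ando.
Variables (R : realType) (k : scalar_kind) (p q : nat).
Local Notation D := (scalar R k).
Local Notation n := (p + q)%N.
Local Notation P := (@posdef_mx R k n).

Definition Jmx : 'M[D]_n := block_mx 1%:M 0 0 (- 1%:M).
Local Notation J := Jmx.

Definition sharp (X : 'M[D]_n) : 'M[D]_n := J *m ctrmx X *m J.

Definition J_posdef_mx : set 'M[D]_n :=
  [set X | X = sharp X /\ posdef_mx (J *m X)].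
Local Notation PJ := J_posdef_mx.

Definition J_le (A B : 'M[D]_n) : Prop := loewner_le (J *m A) (J *m B).

Definition J_kubo_ando_mean (s : PJ -> PJ -> PJ) : Prop :=
  [/\ continuous (fun AB : PJ * PJ => s AB.1 AB.2),
      forall A B C E : PJ,
        J_le (set_val A) (set_val B) -> J_le (set_val C) (set_val E) ->
        J_le (set_val (s A C)) (set_val (s B E)),
      forall (g : 'M[D]_n) (A B gA gB : PJ), invertible_mx g ->
        set_val gA = sharp g *m set_val A *m g ->
        set_val gB = sharp g *m set_val B *m g ->
        sharp g *m set_val (s A B) *m g = set_val (s gA gB) &
      forall JJ : PJ, set_val JJ = J -> s JJ JJ = JJ].

Fact mulJJ : J *m J = 1%:M.
Proof.
rewrite /J mulmx_block !mulmx0 !mul0mx !mulmx1 !addr0 add0r.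
by rewrite mulmxN mulmx1 opprK -scalar_mx_block.
Qed.

Fact ctrmx_J : ctrmx J = J.
Proof.
rewrite /ctrmx tr_block_mx map_block_mx; congr block_mx;
  apply/matrixP => i j; rewrite !mxE ?conjs0// ?conjsN eq_sym;
  by case: (_ == _); rewrite ?conjs1 ?conjs0.
Qed.

Fact mulJ_posdef (X : PJ) : P (J *m set_val X).
Proof. by have /set_mem[] := valP X. Qed.

Fact mulJ_J_posdef (X : P) : PJ (J *m set_val X).
Proof.
have /set_mem XP := valP X.
split; last by rewrite mulmxA mulJJ mul1mx; exact: XP.
have [XE _] := XP.
by rewrite /sharp ctrmx_mul ctrmx_J -XE !mulmxA -mulmxA mulJJ mulmx1.
Qed.

Definition from_PJ (X : PJ) : P := SigSub (mem_set (mulJ_posdef X)).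
Definition to_PJ (X : P) : PJ := SigSub (mem_set (mulJ_J_posdef X)).

(* X s Y = J ((JX) sJ (JY)) *)
Definition associated_mean (sJ : PJ -> PJ -> PJ) : P -> P -> P :=
  fun X Y => from_PJ (sJ (to_PJ X) (to_PJ Y)).

Definition bullet (A B : 'M[D]_n) : 'M[D]_n := A *m J *m B.

Definition J_pow (t : R) (X : 'M[D]_n) : 'M[D]_n := J *m powR_mx t (J *m X).

Definition J_fun (f : {posnum R} -> {posnum R}) (X : 'M[D]_n) : 'M[D]_n :=
  J *m fun_calc f (J *m X).

Definition J_mean_formula (sJ : PJ -> PJ -> PJ)
    (f : {posnum R} -> {posnum R}) : Prop :=
  forall A B : PJ,
    let rA := J_pow 2^-1 (set_val A) in
    let rA' := J_pow (- 2^-1) (set_val A) in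
    set_val (sJ A B) =
      bullet (bullet rA (J_fun f (bullet (bullet rA' (set_val B)) rA'))) rA.

(* For a fixed n the axioms of a mean do not force a representing function to
   exist: for p + q = 1 over the reals, J = 1, the maximum of two positive reals
   satisfies all of them, but t |-> max(1, t) is not operator monotone. *)
Definition representable_J_mean : set (PJ -> PJ -> PJ) :=
  [set sJ | J_kubo_ando_mean sJ /\
            exists f, representing_function (associated_mean sJ) f].

End J_kubo_ando.

(* Main.v *)
Require Import Defs.
From HB Require Import structures.
From mathcomp Require Import all_boot all_order all_algebra.
From mathcomp Require Import all_classical all_reals all_analysis.
From mathcomp Require Import complex ring lra.

Set Implicit Arguments.
Unset Strict Implicit.
Unset Printing Implicit Defensive.

Import Order.TTheory GRing.Theory Num.Theory.
Import numFieldNormedType.Exports.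

Local Open Scope classical_set_scope.
Local Open Scope ring_scope.

(** Multiplication by [J] is an order isomorphism and a homeomorphism between
P_J and P, in both directions, and turns the congruence [X |-> g^# X g] into
[X |-> g^* X g].  Hence [sJ] is a J-Kubo-Ando mean if and only if its
associated mean is a Kubo-Ando mean, and in the formula for [sJ] all factors
[J] cancel but one, which leaves [J] times the usual formula on P.  So the
theorem amounts to the following: over each of the three scalar rings, a
normalized operator monotone function [f] defines a Kubo-Ando mean on P
([mean_kubo_ando]), and it is determined by this mean, because the mean of
the identity and [x Id] is [f(x) Id].

The mean is handled through one description ([mean_mxE]).  If [A = G G^*] and
[B = G diag(l) G^*] with [G] invertible, then the mean of [A] and [B] is
[G diag(f(l)) G^*].  Such [G] and [l] exist by the spectral theorem, and the
result does not depend on them.  Invariance under congruence, homogeneity and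
compatibility with direct sums are then immediate.

Monotonicity in the second argument is monotonicity of [f] on matrices over
the scalar ring, which comes from the complex case by the *-embedding of the
quaternions, and so of all three rings, into 2 x 2 complex matrices
([fun_calc_monotone]).  Monotonicity in the first argument is obtained by
doubling the size.  If [G] is the difference of two positive definite matrices
[A] and [A + G], a congruence takes the direct sum of [A] and [G] to the
direct sum of [A + G] and [A^-1 + G^-1]; comparing means of such direct sums
in the second argument shows that the mean of [A] and [Y] is below that of
[A + G] and [c Y] for every [c > 1] ([mean_superadditive]).  Applied to [A]
and [c B] where [A] is below [B], homogeneity turns the bound into [c] times
the mean of [B] and [Y], and [c] tends to 1 ([mean_mono_l]).

Continuity is a consequence of monotonicity and homogeneity, because the order
intervals [[A / c, c A]] form a base of neighbourhoods of [A] in P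
([nbhs_order_interval], [order_interval_nbhs]).

The spectral theorem is proved for the three rings at once ([spectral]): a
Hermitian matrix has an eigenvector with a real eigenvalue, found over the
complex numbers, and a Householder reflection splits it off.  Over the
quaternions it also identifies positivity of the right eigenvalues with
positivity of the quadratic form ([eigenvalue_form]). *)

(** * The three scalar rings *)

Section scalars.
Variable R : realType.
Local Notation scalar := Defs.scalar.

Definition sqnorm (k : scalar_kind) : scalar R k -> R :=
  match k return scalar R k -> R with
  | RealScalars => fun x : R => x ^+ 2
  | ComplexScalars => fun x : R[i] => complex.Re x ^+ 2 + complex.Im x ^+ 2
  | QuaternionScalars => fun x : quaternion R =>
      qr x ^+ 2 + qi x ^+ 2 + qj x ^+ 2 + qk x ^+ 2
  end.

Lemma conjs_mul_self k (x : scalar R k) : conjs x * x = reals (sqnorm x).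
Proof.
case: k x => /= [x|[a b]|[a b c d]] //.
- by rewrite /GRing.mul /= /conjs /reals /=; simpc; congr Complex; ring.
- by rewrite /GRing.mul /= /conjs /reals /= /realq; congr Quat; ring.
Qed.

Lemma sqnorm_conjs k (x : scalar R k) : sqnorm (conjs x) = sqnorm x.
Proof.
case: k x => /= [x|[a b]|[a b c d]] //; rewrite /conjs /=; ring.
Qed.

Lemma sqnorm_ge0 k (x : scalar R k) : 0 <= sqnorm x.
Proof. by case: k x => /= *; rewrite ?addr_ge0 ?sqr_ge0. Qed.

Lemma sqnorm_eq0 k (x : scalar R k) : sqnorm x = 0 -> x = 0.
Proof.
case: k x => /= [x|[a b]|[a b c d]] /=.
- by move/eqP; rewrite sqrf_eq0 => /eqP.
- move/eqP; rewrite paddr_eq0 ?sqr_ge0// !sqrf_eq0 => /andP[/eqP-> /eqP->] //.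
- move/eqP; rewrite !paddr_eq0 ?addr_ge0 ?sqr_ge0// !sqrf_eq0.
  by move=> /andP[/andP[/andP[/eqP-> /eqP->] /eqP->] /eqP->].
Qed.

Lemma reals_inj k : injective (@reals R (scalar R k)).
Proof. by case: k => [r s //|r s []|r s []]. Qed.

Lemma conjs_fixed_real k (x : scalar R k) :
  conjs x = x -> exists r, x = reals r.
Proof.
have self0 (b : R) : - b = b -> b = 0 by lra.
case: k x => /= [x|[a b]|[a b c d]]; first by exists x.
- by case=> /self0 ->; exists a.
- by case=> /self0 -> /self0 -> /self0 ->; exists a.
Qed.

(** The coordinates of [x = ca x + cb x * j] in H = C + C j.  Both R and C are
*-subalgebras of H, so these two maps embed each of the three rings into the
2 x 2 complex matrices [[a, b], [- conj b, conj a]]. *)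
Definition ca (k : scalar_kind) : scalar R k -> scalar R ComplexScalars :=
  match k return scalar R k -> scalar R ComplexScalars with
  | RealScalars => fun x : R => Complex x 0
  | ComplexScalars => fun x => x
  | QuaternionScalars => fun x : quaternion R => Complex (qr x) (qi x)
  end.
Definition cb (k : scalar_kind) : scalar R k -> scalar R ComplexScalars :=
  match k return scalar R k -> scalar R ComplexScalars with
  | RealScalars => fun x : R => 0
  | ComplexScalars => fun x => 0
  | QuaternionScalars => fun x : quaternion R => Complex (qj x) (qk x)
  end.

Lemma caD k : {morph @ca k : x y / x + y}.
Proof.
case: k => // [x y|[a b c d] [a' b' c' d']] //=; apply/eqP.
by rewrite eq_complex /= ?addr0 !eqxx.
Qed.
Lemma cbD k : {morph @cb k : x y / x + y}.
Proof.
by case: k => [x y|x y|[a b c d] [a' b' c' d']] /=; rewrite ?addr0.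
Qed.
Lemma caM k (x y : scalar R k) : ca (x * y) = ca x * ca y - cb x * conjs (cb y).
Proof.
case: k x y => [x y|x y|[a b c d] [a' b' c' d']] /=; rewrite ?mul0r ?subr0 //.
  by apply/eqP; rewrite eq_complex /=; apply/andP; split; apply/eqP; ring.
by apply/eqP; rewrite eq_complex /=; apply/andP; split; apply/eqP; ring.
Qed.
Lemma cbM k (x y : scalar R k) : cb (x * y) = ca x * cb y + cb x * conjs (ca y).
Proof.
case: k x y => [x y|x y|[a b c d] [a' b' c' d']] /=; rewrite ?mul0r ?mulr0 ?addr0 //.
by apply/eqP; rewrite eq_complex /=; apply/andP; split; apply/eqP; ring.
Qed.
Lemma ca_conjs k (x : scalar R k) : ca (conjs x) = conjs (ca x).
Proof. by case: k x => [x|x|[a b c d]] //=; rewrite /conjs /= oppr0. Qed.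
Lemma cb_conjs k (x : scalar R k) : cb (conjs x) = - cb x.
Proof. by case: k x => [x|x|[a b c d]] //=; rewrite oppr0. Qed.
Lemma ca_reals k r : ca (reals r : scalar R k) = reals r.
Proof. by case: k. Qed.
Lemma cb_reals k r : cb (reals r : scalar R k) = 0.
Proof. by case: k. Qed.


Lemma nbhs_initialP (S : choiceType) (T : topologicalType) (f : S -> T)
    (x : initial_topology f) (A : set S) :
  nbhs x A <-> exists2 B, nbhs (f x) B & forall y, B (f y) -> A y.
Proof.
split.
- case=> U [[V oV fVU] Ux UA]; exists V.
    by apply: open_nbhs_nbhs; split=> //; move: Ux; rewrite -fVU.
  by move=> y Vy; apply: UA; rewrite -fVU.
- move=> [B nB BA]; have := @initial_continuous _ _ f x B nB.
  by apply: (@filterS _ (nbhs x)) => y; apply: BA.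
Qed.

Lemma sqr_lt_norm (a e : R) : 0 < e -> (a ^+ 2 < e ^+ 2) = (`|a| < e).
Proof.
by move=> e0; rewrite -real_normK ?num_real // ltr_pXn2r// ?nnegrE ltW.
Qed.

Lemma nbhs_scalarP k (x : scalar R k) (A : set (scalar R k)) :
  nbhs x A <-> exists2 e : R, 0 < e & forall y, sqnorm (y - x) < e -> A y.
Proof.
(* Balls are given by norms, of which [sqnorm] is the square. *)
have key (B : set (scalar R k)) :
   (exists2 e : R, 0 < e & forall y, sqnorm (y - x) < e ^+ 2 -> B y) <->
   (exists2 e : R, 0 < e & forall y, sqnorm (y - x) < e -> B y).
  split=> -[e e0 eB]; first by exists (e ^+ 2) => //; rewrite exprn_gt0.
  by exists (Num.sqrt e); rewrite ?sqrtr_gt0 // sqr_sqrtr // ltW.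
rewrite -key; case: k x A {key} => [x A|x A|x A].
- apply: (iff_trans (@nbhs_ballP R R^o x A)).
  split=> -[e /= e0 eA]; exists e => // y; last first.
    rewrite /ball /= => xy; apply: eA => /=.
    by rewrite sqr_lt_norm // -normrN opprB.
  by rewrite /= sqr_lt_norm // => yx; apply: eA; rewrite /ball /= -normrN opprB.
- apply: (iff_trans (@nbhs_ballP R[i] (R[i] : numFieldType)^o x A)).
  have nE (e : R) (y : R[i]) : 0 < e ->
      (`|y| < e%:C%C) = (sqnorm (y : scalar R ComplexScalars) < e ^+ 2).
    move=> e0; rewrite normc_def ltcR -[X in _ < X](@ger0_norm _ e) ?ltW//.
    by rewrite -sqrtr_sqr ltr_sqrt ?exprn_gt0.
  split=> -[e /= e0 eA].
    case: e e0 eA => e e'; rewrite ltcE /= => /andP[/eqP -> e0] eA.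
    by exists e => // y ye; apply: eA; rewrite /ball /= -normrN opprB nE.
  exists (e%:C%C); first by rewrite /= ltcR.
  by move=> y; rewrite /ball /= -normrN opprB nE //; apply: eA.
- split.
    case/(nbhs_initialP (f := @coordq R)) => B.
    case: x => a b c d [[B1 B2] /= [[[P Q] /= [[[S T] /= []]]]]].
    move=> /nbhs_ballP[e1 /= e10 h1] /nbhs_ballP[e2 /= e20 h2] hST.
    move=> /nbhs_ballP[e3 /= e30 h3] hPQ /nbhs_ballP[e4 /= e40 h4] hB BA.
    pose e := Num.min (Num.min e1 e2) (Num.min e3 e4).
    have e0 : 0 < e by rewrite !lt_min e10 e20 e30 e40.
    exists e => // -[a' b' c' d'] /= h.
    have hn (u v w z t : R) : t ^+ 2 <= v -> v < e ^+ 2 -> e <= w -> `|t| < w.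
      move=> tv ve; apply: lt_le_trans.
      by rewrite -sqr_lt_norm //; apply: le_lt_trans ve.
    apply: BA; apply: (hB (a', b', c', d')); split.
      apply: (hPQ (a', b', c')); split; first (apply: (hST (a', b')); split).
    + apply: h1; rewrite /ball /= -normrN opprB.
      apply: hn h _ => //; last by rewrite ?ge_min ?lexx ?orbT.
      by rewrite -!addrA lerDl !addr_ge0 ?sqr_ge0.
    + apply: h2; rewrite /ball /= -normrN opprB.
      apply: hn h _ => //; last by rewrite ?ge_min ?lexx ?orbT.
      by rewrite -!addrA [leRHS]addrCA lerDl !addr_ge0 ?sqr_ge0.
    + apply: h3; rewrite /ball /= -normrN opprB.
      apply: hn h _ => //; last by rewrite ?ge_min ?lexx ?orbT.
      by rewrite -addrA [leRHS]addrCA lerDl !addr_ge0 ?sqr_ge0.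
    + apply: h4; rewrite /ball /= -normrN opprB.
      apply: hn h _ => //; last by rewrite ?ge_min ?lexx ?orbT.
      by rewrite [leRHS]addrC lerDl !addr_ge0 ?sqr_ge0.
  case=> e e0 eA; apply/(nbhs_initialP (f := @coordq R)).
  case: x eA => a b c d eA.
  have e20 : 0 < e / 2 by rewrite divr_gt0.
  exists [set z | ball a (e/2) z.1.1.1 /\ ball b (e/2) z.1.1.2 /\
                  ball c (e/2) z.1.2 /\ ball d (e/2) z.2].
    exists (ball a (e/2) `*` ball b (e/2) `*` ball c (e/2), ball d (e/2)) => /=;
      last by case=> [[[u v] w] z] [[[? ?] ?] ?].
    split; last exact: nbhsx_ballx.
    exists (ball a (e/2) `*` ball b (e/2), ball c (e/2)) => //=.
    split; last exact: nbhsx_ballx.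
    exists (ball a (e/2), ball b (e/2)) => //=.
    by split; exact: nbhsx_ballx.
  case=> a' b' c' d' /=; rewrite /ball /= => -[ha [hb [hc hd]]]; apply: eA => /=.
  have hn (u v : R) : `|u - v| < e / 2 -> (v - u) ^+ 2 < e ^+ 2 / 4.
    have -> : e ^+ 2 / 4 = (e / 2) ^+ 2 by field.
    by rewrite sqr_lt_norm // -normrN opprB.
  have := hn _ _ ha; have := hn _ _ hb; have := hn _ _ hc; have := hn _ _ hd.
  move: ((a' - a) ^+ 2) ((b' - b) ^+ 2) ((c' - c) ^+ 2) ((d' - d) ^+ 2).
  move: (e ^+ 2) => *; lra.
Qed.
End scalars.

(** * Conjugate transposes and quadratic forms *)

Lemma reals0 (R : realType) (D : starRingType R) : reals 0 = 0 :> D.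
Proof. by apply: (addrI (reals 0)); rewrite -realsD !addr0. Qed.

HB.instance Definition _ (R : realType) (D : starRingType R) :=
  GRing.isNmodMorphism.Build R D (@reals R D)
  (conj (@reals0 R D) (@realsD R D)).
HB.instance Definition _ (R : realType) (D : starRingType R) :=
  GRing.isMonoidMorphism.Build R D (@reals R D) (conj reals1 realsM).
HB.instance Definition _ (R : realType) (D : starRingType R) :=
  GRing.isNmodMorphism.Build D D (@conjs R D) (conj (@conjs0 R D) conjsD).

Section ctrmx_lemmas.
Variables (R : realType) (D : starRingType R).
Implicit Types r s : R.

Definition rdiag n (l : 'I_n -> R) : 'M[D]_n := diag_mx (\row_i reals (l i)).

Lemma ctrmxK m n (A : 'M[D]_(m, n)) : ctrmx (ctrmx A) = A.
Proof. by apply/matrixP => i j; rewrite !mxE conjsK. Qed.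
Lemma ctrmxD m n (A B : 'M[D]_(m, n)) : ctrmx (A + B) = ctrmx A + ctrmx B.
Proof. by apply/matrixP => i j; rewrite !mxE conjsD. Qed.
Lemma ctrmxN m n (A : 'M[D]_(m, n)) : ctrmx (- A) = - ctrmx A.
Proof. by apply/matrixP => i j; rewrite !mxE conjsN. Qed.
Lemma ctrmxZ m n r (A : 'M[D]_(m, n)) :
  ctrmx (reals r *: A) = reals r *: ctrmx A.
Proof. by apply/matrixP => i j; rewrite !mxE conjsM conjs_real reals_comm. Qed.
Lemma ctrmx1 n : ctrmx 1%:M = 1%:M :> 'M[D]_n.
Proof.
by apply/matrixP => i j; rewrite !mxE eq_sym; case: eqP; rewrite ?conjs1 ?conjs0.
Qed.
Lemma ctrmx0 m n : ctrmx 0 = 0 :> 'M[D]_(m, n).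
Proof. by apply/matrixP => i j; rewrite !mxE conjs0. Qed.
Lemma ctrmx_rdiag n (l : 'I_n -> R) : ctrmx (rdiag l) = rdiag l.
Proof.
apply/matrixP => i j; rewrite !mxE eq_sym.
by case: eqP => [->|_]; rewrite ?mulr1n ?mulr0n ?conjs0 ?conjs_real.
Qed.
Lemma ctrmx_block m1 m2 n1 n2 (A : 'M[D]_(m1, n1)) (B : 'M[D]_(m1, n2))
    (C : 'M[D]_(m2, n1)) (E : 'M[D]_(m2, n2)) :
  ctrmx (block_mx A B C E) = block_mx (ctrmx A) (ctrmx C) (ctrmx B) (ctrmx E).
Proof. by rewrite /ctrmx tr_block_mx map_block_mx. Qed.
Lemma ctrmx_row m n1 n2 (A : 'M[D]_(m, n1)) (B : 'M[D]_(m, n2)) :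
  ctrmx (row_mx A B) = col_mx (ctrmx A) (ctrmx B).
Proof. by rewrite /ctrmx tr_row_mx map_col_mx. Qed.
Lemma ctrmx_col m n1 n2 (A : 'M[D]_(n1, m)) (B : 'M[D]_(n2, m)) :
  ctrmx (col_mx A B) = row_mx (ctrmx A) (ctrmx B).
Proof. by rewrite /ctrmx tr_col_mx map_row_mx. Qed.

Lemma mulmxZ m n p r (A : 'M[D]_(m, n)) (B : 'M[D]_(n, p)) :
  A *m (reals r *: B) = reals r *: (A *m B).
Proof.
apply/matrixP => i j; rewrite !mxE mulr_sumr; apply: eq_bigr => l _.
by rewrite !mxE !mulrA reals_comm.
Qed.
Lemma mulmx_reals m n r (A : 'M[D]_(m, n)) : A *m (reals r)%:M = reals r *: A.
Proof. by rewrite -[(reals r)%:M]scalemx1 mulmxZ mulmx1. Qed.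

Lemma rdiagM n (l m : 'I_n -> R) : rdiag l *m rdiag m = rdiag (fun i => l i * m i).
Proof.
by rewrite /rdiag mulmx_diag; congr diag_mx; apply/rowP => i; rewrite !mxE realsM.
Qed.
Lemma rdiag1 n : rdiag (fun=> 1) = 1%:M :> 'M[D]_n.
Proof. by apply/matrixP => i j; rewrite !mxE reals1. Qed.
Lemma eq_rdiag n (l m : 'I_n -> R) : l =1 m -> rdiag l = rdiag m.
Proof. by move=> /funext ->. Qed.
Definition ord_cat T n1 n2 (l : 'I_n1 -> T) (m : 'I_n2 -> T)
    (i : 'I_(n1 + n2)) : T :=
  match fintype.split i with inl j => l j | inr j => m j end.

Lemma rdiag_block n1 n2 (l : 'I_n1 -> R) (m : 'I_n2 -> R) :
  block_mx (rdiag l) 0 0 (rdiag m) = rdiag (ord_cat l m).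
Proof.
apply/matrixP => i j; rewrite !mxE /ord_cat; case: (splitP i) => a ia; rewrite !mxE;
  case: (splitP j) => b jb; rewrite !mxE.
- by congr (_ *+ _); rewrite -!(inj_eq val_inj) /= ia jb.
- by rewrite -(inj_eq val_inj) /= ia jb ltn_eqF ?mulr0n // ltn_addr.
- by rewrite -(inj_eq val_inj) /= ia jb gtn_eqF ?mulr0n // ltn_addr.
- by congr (_ *+ _); rewrite -!(inj_eq val_inj) /= ia jb eqn_add2l.
Qed.

Definition unitary n (U : 'M[D]_n) :=
  U *m ctrmx U = 1%:M /\ ctrmx U *m U = 1%:M.

Lemma unitary_mul n (U V : 'M[D]_n) :
  unitary U -> unitary V -> unitary (U *m V).
Proof.
move=> [U1 U2] [V1 V2]; split; rewrite ctrmx_mul.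
  by rewrite mulmxA -(mulmxA U) V1 mulmx1.
by rewrite mulmxA -(mulmxA _ _ U) U2 mulmx1.
Qed.
Lemma unitary_ctrmx n (U : 'M[D]_n) : unitary U -> unitary (ctrmx U).
Proof. by rewrite /unitary ctrmxK => -[]. Qed.

End ctrmx_lemmas.
Arguments rdiag {R D n} l.

Section forms.
Variables (R : realType) (k : scalar_kind).
Local Notation D := (Defs.scalar R k).

Definition vsqnorm n (v : 'cV[D]_n) : R := \sum_i sqnorm (v i 0).

Lemma vsqnormE n (v : 'cV[D]_n) : ctrmx v *m v = (reals (vsqnorm v))%:M.
Proof.
apply/matrixP => i j; rewrite !ord1 !mxE mulr1n rmorph_sum; apply: eq_bigr => l _.
by rewrite !mxE conjs_mul_self.
Qed.
Lemma vsqnorm_ge0 n (v : 'cV[D]_n) : 0 <= vsqnorm v.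
Proof. by apply: sumr_ge0 => i _; exact: sqnorm_ge0. Qed.
Lemma vsqnorm_gt0 n (v : 'cV[D]_n) : v != 0 -> 0 < vsqnorm v.
Proof.
move=> v0; rewrite lt_neqAle vsqnorm_ge0 andbT; apply: contra v0 => /eqP/esym /eqP.
rewrite psumr_eq0 => [/allP h|i _]; last exact: sqnorm_ge0.
apply/eqP/colP => i; rewrite mxE; apply: sqnorm_eq0; apply/eqP/h.
by rewrite mem_index_enum.
Qed.

(** The value is its own conjugate, and self-conjugate scalars are real. *)
Lemma hermitian_form n (X : 'M[D]_n) (v : 'cV[D]_n) : hermitian_mx X ->
  exists r, ctrmx v *m X *m v = (reals r)%:M.
Proof.
move=> hX; set Y := ctrmx v *m X *m v.
have hY : Y = ctrmx Y by rewrite /Y !ctrmx_mul ctrmxK -hX mulmxA.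
have [r Yr] : exists r, Y 0 0 = reals r.
  by apply: conjs_fixed_real; rewrite {2}hY !mxE.
by exists r; apply/matrixP => i j; rewrite !ord1 Yr !mxE.
Qed.

Lemma reals_mx_inj n : (0 < n)%N ->
  injective (fun r => (reals r : D)%:M : 'M[D]_n).
Proof.
case: n => // n _ r s /matrixP /(_ 0 0); rewrite !mxE; exact: reals_inj.
Qed.

Lemma hermitian_eigenvalue_real n (X : 'M[D]_n) (v : 'cV[D]_n) (a : D) :
  hermitian_mx X -> v != 0 -> X *m v = v *m a%:M -> exists r, a = reals r.
Proof.
move=> hX v0 Xv; have [r] := hermitian_form v hX.
rewrite -mulmxA Xv mulmxA vsqnormE => /matrixP /(_ 0 0).
rewrite -scalar_mxM !mxE !mulr1n => ar; exists ((vsqnorm v)^-1 * r).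
by rewrite realsM -ar mulrA -realsM mulVf ?reals1 ?mul1r ?gt_eqF ?vsqnorm_gt0.
Qed.
End forms.

(** * Embedding into complex matrices, and eigenvectors *)

Section embedding.
Variables (R : realType) (k : scalar_kind).
Local Notation D := (Defs.scalar R k).
Local Notation C := (Defs.scalar R ComplexScalars).

Definition conjm m n (A : 'M[C]_(m, n)) : 'M[C]_(m, n) := map_mx (@conjs R C) A.

(** The *-embedding of [D]-matrices into complex ones, with the blocks gathered:
[X = A + B j] becomes [[A, B], [- conj B, conj A]].  It carries to [D] what
is known, or assumed, for complex matrices only. *)
Definition cmx m n (X : 'M[D]_(m, n)) : 'M[C]_(m + m, n + n) :=
  block_mx (map_mx (@ca R k) X) (map_mx (@cb R k) X)
           (- conjm (map_mx (@cb R k) X)) (conjm (map_mx (@ca R k) X)).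

Lemma ca0 : ca (0 : D) = 0.
Proof. by apply: (addrI (ca (0 : D))); rewrite -caD !addr0. Qed.
Lemma cb0 : cb (0 : D) = 0.
Proof. by apply: (addrI (cb (0 : D))); rewrite -cbD !addr0. Qed.

Lemma map_caM m n p (A : 'M[D]_(m, n)) (B : 'M[D]_(n, p)) :
  map_mx (@ca R k) (A *m B) =
  map_mx (@ca R k) A *m map_mx (@ca R k) B -
  map_mx (@cb R k) A *m conjm (map_mx (@cb R k) B).
Proof.
apply/matrixP => i j; rewrite !mxE (big_morph _ (@caD R k) ca0) -sumrB.
by apply: eq_bigr => l _; rewrite !mxE caM.
Qed.
Lemma map_cbM m n p (A : 'M[D]_(m, n)) (B : 'M[D]_(n, p)) :
  map_mx (@cb R k) (A *m B) =
  map_mx (@ca R k) A *m map_mx (@cb R k) B +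
  map_mx (@cb R k) A *m conjm (map_mx (@ca R k) B).
Proof.
apply/matrixP => i j; rewrite !mxE (big_morph _ (@cbD R k) cb0) -big_split.
by apply: eq_bigr => l _; rewrite !mxE cbM.
Qed.
Lemma conjmM m n p (A : 'M[C]_(m, n)) (B : 'M[C]_(n, p)) :
  conjm (A *m B) = conjm A *m conjm B.
Proof.
apply/matrixP => i j; rewrite !mxE (big_morph _ (@conjsD R C) (@conjs0 R C)).
by apply: eq_bigr => l _; rewrite !mxE conjsM mulrC.
Qed.
Lemma conjmK m n (A : 'M[C]_(m, n)) : conjm (conjm A) = A.
Proof. by apply/matrixP => i j; rewrite !mxE conjsK. Qed.
Lemma conjmD m n (A B : 'M[C]_(m, n)) : conjm (A + B) = conjm A + conjm B.
Proof. by apply/matrixP => i j; rewrite !mxE conjsD. Qed.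
Lemma conjmN m n (A : 'M[C]_(m, n)) : conjm (- A) = - conjm A.
Proof. by apply/matrixP => i j; rewrite !mxE conjsN. Qed.

Lemma cmxM m n p (A : 'M[D]_(m, n)) (B : 'M[D]_(n, p)) :
  cmx (A *m B) = cmx A *m cmx B.
Proof.
rewrite /cmx mulmx_block map_caM map_cbM; congr block_mx.
- by rewrite mulmxN.
- by rewrite conjmD !conjmM conjmK mulNmx mulmxN addrC opprD.
- by rewrite conjmD conjmN !conjmM conjmK addrC mulNmx.
Qed.

Lemma cmxB m n (A B : 'M[D]_(m, n)) : cmx (A - B) = cmx A - cmx B.
Proof.
have caB x y : ca (x - y : D) = ca x - ca y.
  by apply: (addIr (ca y)); rewrite -caD !subrK.
have cbB x y : cb (x - y : D) = cb x - cb y.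
  by apply: (addIr (cb y)); rewrite -cbD !subrK.
rewrite /cmx opp_block_mx add_block_mx; congr block_mx; apply/matrixP => i j;
  rewrite !mxE ?caB ?cbB ?conjsD ?conjsN ?opprD //.
Qed.

Lemma cmx_ctrmx m n (A : 'M[D]_(m, n)) : cmx (ctrmx A) = ctrmx (cmx A).
Proof.
rewrite /cmx ctrmx_block; congr block_mx; apply/matrixP => i j;
  rewrite !mxE ?ca_conjs ?cb_conjs ?conjsN ?conjsK ?opprK //.
Qed.

Lemma cmx_rdiag n (l : 'I_n -> R) :
  cmx (rdiag l) = rdiag (ord_cat l l).
Proof.
rewrite -rdiag_block /cmx; congr block_mx; apply/matrixP => i j; rewrite !mxE;
  case: (i == j); rewrite ?mulr1n ?mulr0n ?ca0 ?cb0 ?ca_reals ?cb_reals;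
  by rewrite ?conjs0 ?oppr0 ?conjs_real.
Qed.

Lemma cmx1 n : cmx (1%:M : 'M[D]_n) = 1%:M.
Proof.
rewrite -rdiag1 cmx_rdiag -[RHS]rdiag1; apply: eq_rdiag => i.
by rewrite /ord_cat; case: (fintype.split i).
Qed.

Lemma cmx_unitary n (U : 'M[D]_n) : unitary U -> unitary (cmx U).
Proof. by move=> [U1 U2]; split; rewrite -cmx_ctrmx -cmxM ?U1 ?U2 cmx1. Qed.

End embedding.

Section eigenvector.
Variable R : realType.
Local Notation C := (Defs.scalar R ComplexScalars).

Lemma complex_eigenvector n (X : 'M[C]_n) : (0 < n)%N -> hermitian_mx X ->
  exists r, exists2 v : 'cV[C]_n, v != 0 & X *m v = reals r *: v.
Proof.
move=> n0 hX.
have [a /eigenvalueP[u uX u0]] :=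
  @eigenvalue_closed (R[i] : numClosedFieldType) n (X^T) n0.
have v0 : (u^T : 'cV[C]_n) != 0.
  by rewrite -(inj_eq (@trmx_inj _ _ _)) trmxK trmx0.
have Xv : X *m (u^T : 'cV[C]_n) = a *: u^T.
  by rewrite -[LHS]trmxK (trmx_mul X) trmxK; rewrite uX linearZ.
have Xv' : X *m (u^T : 'cV[C]_n) = u^T *m (a : C)%:M.
  by rewrite Xv; apply/matrixP => i j; rewrite !mxE big_ord1 !mxE ord1 mulrC.
have [r ar] := hermitian_eigenvalue_real hX v0 Xv'.
by exists r; exists (u^T); rewrite // -ar.
Qed.

(** Complex eigenvalues exist because the field is algebraically closed, and are
real for Hermitian matrices.  A real matrix is viewed as a complex one, a
quaternionic matrix [X] through [cmx X], and an eigenvector over [D] is read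
off the complex eigenvector. *)
Lemma eigenvector k n (X : 'M[Defs.scalar R k]_n) :
  (0 < n)%N -> hermitian_mx X ->
  exists r, exists2 v : 'cV[Defs.scalar R k]_n, v != 0 & X *m v = reals r *: v.
Proof.
case: k X => X n0 hX; last first.
- have hcX : hermitian_mx (cmx X) by rewrite /hermitian_mx -cmx_ctrmx -hX.
  have [|r [w w0 Xw]] := complex_eigenvector _ hcX.
    by rewrite addn_gt0 n0.
  exists r.
  (* [v] is chosen so that [w] is the first column of [cmx v]. *)
  pose w1 := usubmx w; pose w2 := dsubmx w.
  pose v : 'cV[quaternion R]_n := \col_i
    Quat (complex.Re (w1 i 0)) (complex.Im (w1 i 0))
         (- complex.Re (w2 i 0)) (complex.Im (w2 i 0)).
  have vca : map_mx (@ca R QuaternionScalars) v = w1.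
    by apply/colP => i; rewrite !mxE /=; case: (w _ _).
  have vcb : map_mx (@cb R QuaternionScalars) v = - conjm w2.
    apply/colP => i; rewrite !mxE /=; case: (w _ _) => a b; rewrite /conjs /=.
    by apply/eqP; rewrite eq_complex /= opprK !eqxx.
  have wE : w = col_mx w1 w2 by rewrite vsubmxK.
  have : cmx X *m w = reals r *: w := Xw.
  rewrite wE mul_block_col scale_col_mx => /eq_col_mx [E1 E2].
  exists v.
    apply: contraNneq w0 => v0; rewrite wE; apply/eqP.
    have z1 : w1 = 0 by rewrite -vca v0; apply/matrixP => i j; rewrite !mxE.
    have z2 : w2 = 0.
      rewrite -[w2]conjmK -[conjm w2]opprK -vcb v0; apply/matrixP => i j.
      by rewrite !mxE /conjs /= !oppr0.
    by rewrite z1 z2 col_mx0.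
  have ext (x y : 'cV[Defs.scalar R QuaternionScalars]_n) :
    map_mx (@ca R _) x = map_mx (@ca R _) y ->
    map_mx (@cb R _) x = map_mx (@cb R _) y -> x = y.
    move=> /matrixP e1 /matrixP e2; apply/matrixP => i j.
    move: (e1 i j) (e2 i j); rewrite !mxE.
    case: (x i j) (y i j) => a b c d [a' b' c' d'] /=.
    by case=> -> -> [-> ->].
  have Zca s (x : 'cV[Defs.scalar R QuaternionScalars]_n) :
     map_mx (@ca R _) (reals s *: x) = reals s *: map_mx (@ca R _) x.
    by apply/matrixP => i j; rewrite !mxE caM ca_reals cb_reals mul0r subr0.
  have Zcb s (x : 'cV[Defs.scalar R QuaternionScalars]_n) :
     map_mx (@cb R _) (reals s *: x) = reals s *: map_mx (@cb R _) x.
    by apply/matrixP => i j; rewrite !mxE cbM ca_reals cb_reals mul0r addr0.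
  have Zconj s (x : 'cV[C]_n) : conjm (reals s *: x) = reals s *: conjm x.
    by apply/matrixP => i j; rewrite !mxE conjsM conjs_real mulrC.
  apply: ext.
    by rewrite map_caM Zca vca vcb conjmN conjmK mulmxN opprK E1.
  rewrite map_cbM Zcb vca vcb scalerN -Zconj -E2 conjmD mulNmx conjmN.
  by rewrite !conjmM !conjmK mulmxN opprD opprK addrC.
- exact: complex_eigenvector.
- pose X' : 'M[C]_n := map_mx (@ca R RealScalars) X.
  have hX' : hermitian_mx X'.
    rewrite /hermitian_mx {1}/X' {1}hX; apply/matrixP => i j; rewrite !mxE.
    by rewrite /conjs /= oppr0.
  have [r [w w0 Xw]] := complex_eigenvector n0 hX'.
  exists r.
  (* The matrix being real, both the real and imaginary parts are eigenvectors
     or zero. *)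
  pose w1 : 'cV[R]_n := map_mx (@complex.Re R) w.
  pose w2 : 'cV[R]_n := map_mx (@complex.Im R) w.
  have E1 : (X : 'M[R]_n) *m w1 = r *: w1.
    apply/colP => i; have /colP/(_ i) := Xw.
    rewrite !mxE => /(congr1 (@complex.Re R)).
    rewrite (big_morph (@complex.Re R) (id1 := 0) (op1 := +%R)) //;
      last by move=> [? ?] [? ?].
    case: (w i 0) => a b /=; rewrite mul0r subr0 => <-; apply: eq_bigr => j _.
    by rewrite !mxE; case: (w j 0) => c d /=; rewrite mul0r subr0.
  have E2 : (X : 'M[R]_n) *m w2 = r *: w2.
    apply/colP => i; have /colP/(_ i) := Xw.
    rewrite !mxE => /(congr1 (@complex.Im R)).
    rewrite (big_morph (@complex.Im R) (id1 := 0) (op1 := +%R)) //;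
      last by move=> [? ?] [? ?].
    case: (w i 0) => a b /=; rewrite mul0r addr0 => <-; apply: eq_bigr => j _.
    by rewrite !mxE; case: (w j 0) => c d /=; rewrite mul0r addr0.
  have [z1|nz1] := eqVneq w1 0; last by exists w1.
  exists w2 => //; apply: contraNneq w0 => z2; apply/eqP/colP => i.
  move/colP/(_ i): z1; move/colP/(_ i): z2; rewrite !mxE.
  by case: (w i 0) => a b /= -> ->.
Qed.
End eigenvector.

(** * The spectral theorem *)

Section spectral.
Variables (R : realType) (k : scalar_kind).
Local Notation D := (Defs.scalar R k).

Lemma mul_conjs_self (x : D) : x * conjs x = reals (sqnorm x).
Proof. by rewrite -{1}[x]conjsK conjs_mul_self sqnorm_conjs. Qed.

Lemma sqnormM (x y : D) : sqnorm (x * y) = sqnorm x * sqnorm y.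
Proof.
apply: (@reals_inj _ k); rewrite -conjs_mul_self conjsM.
rewrite mulrA -[conjs y * conjs x * x]mulrA conjs_mul_self.
by rewrite -(reals_comm _ (conjs y)) -mulrA conjs_mul_self -realsM.
Qed.

Lemma sqnorm_reals (r : R) : sqnorm (reals r : D) = r ^+ 2.
Proof.
by apply: (@reals_inj _ k); rewrite -conjs_mul_self conjs_real -realsM.
Qed.

Lemma sqnormN (x : D) : sqnorm (- x) = sqnorm x.
Proof.
by rewrite -mulN1r -(reals1 (R := R)) -raddfN sqnormM sqnorm_reals sqrrN expr1n mul1r.
Qed.

(** Right multiplication of a vector by [d] keeps it an eigenvector for a real
eigenvalue and makes its first coordinate a nonnegative real, as the reflection
of [householder] requires. *)
Lemma unit_direction (x : D) :
  exists d : D, exists2 a, 0 <= a & sqnorm d = 1 /\ x * d = reals a.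
Proof.
have [->|x0] := eqVneq x 0.
  exists 1; exists 0; rewrite // mul0r raddf0 -(reals1 (R := R)).
  by rewrite sqnorm_reals expr1n.
have N0 : 0 < sqnorm x.
  rewrite lt_neqAle sqnorm_ge0 andbT.
  by apply: contra x0 => /eqP/esym/sqnorm_eq0 ->.
exists (conjs x * reals (Num.sqrt (sqnorm x))^-1).
exists (Num.sqrt (sqnorm x)) => //.
split.
  by rewrite sqnormM sqnorm_reals sqnorm_conjs exprVn sqr_sqrtr ?mulfV ?ltW ?gt_eqF.
rewrite mulrA mul_conjs_self -realsM; congr reals.
by rewrite -{1}(sqr_sqrtr (ltW N0)) expr2 mulfK // gt_eqF // sqrtr_gt0.
Qed.

(** Scale [v] to a unit vector [u] whose first coordinate [b] is a nonnegative
real.  With [w = u + e0], the matrix [1 - w w^* / (1 + b)] is the reflection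
that sends [e0] to [- u]; here [w^* w = 2 (1 + b)] because [b] is real, and
[1 + b] is nonzero because [b] is nonnegative. *)
Lemma householder n (v : 'cV[D]_(1 + n)) : v != 0 ->
  exists H (c : D), [/\ unitary H, hermitian_mx H &
    H *m col_mx 1%:M 0 = v *m c%:M /\ H *m (v *m c%:M) = col_mx 1%:M 0].
Proof.
move=> v0; have [d [a a0 [d1 vd]]] := unit_direction (v 0 0).
pose s := Num.sqrt (vsqnorm v).
have s0 : 0 < s by rewrite sqrtr_gt0 vsqnorm_gt0.
have ss : s ^+ 2 = vsqnorm v by rewrite sqr_sqrtr // vsqnorm_ge0.
pose c := d * reals s^-1; pose u := v *m c%:M.
pose b := a / s.
have b0 : 0 <= b by rewrite divr_ge0 // ltW.
have u1 : ctrmx u *m u = 1%:M.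
  rewrite vsqnormE; suff -> : vsqnorm u = 1 by rewrite reals1.
  transitivity (vsqnorm v * sqnorm c).
    rewrite /vsqnorm mulr_suml; apply: eq_bigr => i _.
    by rewrite -sqnormM !mxE big_ord1 !mxE mulr1n.
  by rewrite /c sqnormM d1 mul1r sqnorm_reals exprVn ss mulfV // gt_eqF ?vsqnorm_gt0.
pose e0 : 'cV[D]_(1 + n) := col_mx 1%:M 0.
have e01 : ctrmx e0 *m e0 = 1%:M.
  by rewrite ctrmx_col ctrmx1 ctrmx0 mul_row_col mulmx1 mulmx0 addr0.
have e0u : ctrmx e0 *m u = (reals b)%:M.
  rewrite ctrmx_col ctrmx1 ctrmx0 -{1}[u]vsubmxK mul_row_col mul1mx mul0mx addr0.
  apply/matrixP => i j; rewrite !ord1 !mxE big_ord1 !mxE !mulr1n lshift0 /c mulrA vd.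
  by rewrite -realsM.
have ue0 : ctrmx u *m e0 = (reals b)%:M.
  rewrite -[LHS]ctrmxK ctrmx_mul ctrmxK e0u; apply/matrixP => i j.
  by rewrite !mxE !ord1 conjs_real.
pose w := u + e0.
pose t := (1 + b)^-1.
have tb : t * (1 + b) = 1 by rewrite mulVf // gt_eqF // ltr_wpDr.
have ww : ctrmx w *m w = (reals (2 * (1 + b)))%:M.
  rewrite /w ctrmxD mulmxDl !mulmxDr u1 e01 e0u ue0 -(reals1 (R := R)).
  rewrite -!raddfD; congr (_%:M); congr reals; ring.
pose P := w *m ctrmx w.
have PP : P *m P = reals (2 * (1 + b)) *: P.
  by rewrite /P mulmxA -(mulmxA w) ww mulmx_reals scalemxAl.
pose H := 1%:M - reals t *: P.
have hP : ctrmx P = P by rewrite /P ctrmx_mul ctrmxK.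
have hH : ctrmx H = H by rewrite /H ctrmxD ctrmxN ctrmxZ hP ctrmx1.
have HH : H *m H = 1%:M.
  rewrite /H mulmxBl mul1mx mulmxBr mulmx1 mulmxZ -scalemxAl PP !scalerA -!realsM.
  rewrite -{2}[t]mulr1 (mulrC t) -addrA -opprD.
  apply/eqP; rewrite subr_eq addrC -subr_eq subrr eq_sym.
  rewrite -scalerBl -scalerDl -raddfB -raddfD /=.
  rewrite (_ : _ + _ = 0) ?raddf0 ?scale0r //.
  have -> : t * t * (2 * (1 + b)) = 2 * t * (t * (1 + b)) by ring.
  rewrite tb; ring.
have He0 : H *m e0 = - u.
  have we0 : ctrmx w *m e0 = (reals (b + 1))%:M.
    by rewrite /w ctrmxD mulmxDl ue0 e01 -(reals1 (R := R)) -!raddfD.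
  rewrite /H mulmxBl mul1mx -scalemxAl /P -mulmxA we0 mulmx_reals scalerA -realsM.
  by rewrite (addrC b) tb reals1 scale1r /w opprD addrCA subrr addr0.
exists (- H), c; split.
- by rewrite /unitary ctrmxN hH mulNmx mulmxN opprK HH.
- by rewrite /hermitian_mx ctrmxN hH.
split; first by rewrite mulNmx He0 opprK.
by rewrite -/u -[u]opprK -He0 mulNmx mulmxN opprK mulmxA HH mul1mx.
Qed.

Lemma unitary_block n1 n2 (U : 'M[D]_n1) (V : 'M[D]_n2) :
  unitary U -> unitary V -> unitary (block_mx U 0 0 V).
Proof.
move=> [U1 U2] [V1 V2]; split;
by rewrite ctrmx_block !ctrmx0 mulmx_block !mulmx0 !mul0mx !addr0 !add0r
     ?V1 ?V2 ?U1 ?U2 -scalar_mx_block.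
Qed.

(** An eigenvector is moved to the first basis vector by a unitary reflection;
the Hermitian matrix then splits off a real 1 x 1 block. *)
Theorem spectral n (X : 'M[D]_n) : hermitian_mx X ->
  exists U (l : 'I_n -> R), unitary U /\ X = U *m rdiag l *m ctrmx U.
Proof.
elim: n X => [|n IHn] X hX.
  exists 1%:M, (fun=> 0); split; last by apply/matrixP => -[].
  by rewrite /unitary ctrmx1 mulmx1.
have [r [v v0 Xv]] := eigenvector (ltn0Sn n) hX.
have [H [c [UH hH [He0 Hv]]]] := @householder n v v0.
pose Y : 'M[D]_(1 + n) := H *m X *m H.
have hY : hermitian_mx Y by rewrite /hermitian_mx /Y !ctrmx_mul -hH -hX mulmxA.
have Ye0 : Y *m col_mx 1%:M 0 = reals r *: col_mx 1%:M 0.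
  by rewrite /Y -!mulmxA He0 (mulmxA X) Xv -scalemxAl mulmxZ Hv.
have HH : H *m H = 1%:M by rewrite {2}hH; case: UH.
have XE : X = H *m Y *m H.
  by rewrite /Y !mulmxA HH mul1mx -mulmxA HH mulmx1.
move: Ye0; rewrite -[Y]submxK mul_block_col !mulmx1 !mulmx0 !addr0 scale_col_mx.
move=> /eq_col_mx[Yul]; rewrite scaler0 => Ydl.
move: (hY); rewrite /hermitian_mx -{1 2}[Y]submxK ctrmx_block.
move=> /eq_block_mx[_ Yur _ Ydr].
have [V [l [UV YE]]] := IHn _ Ydr.
exists (H *m block_mx 1%:M 0 0 V).
exists (@ord_cat R 1 n (fun=> r) l).
split.
  apply: unitary_mul => //; apply: (@unitary_block 1 n) => //.
  by rewrite /unitary ctrmx1 mulmx1.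
have YD : Y = block_mx 1%:M 0 0 V *m
    block_mx (rdiag (fun=> r)) 0 0 (rdiag l) *m ctrmx (block_mx 1%:M 0 0 V).
  rewrite -[Y]submxK Yul Yur Ydl YE ctrmx0 ctrmx_block ctrmx1 !ctrmx0.
  rewrite !mulmx_block !mulmx0 !mul0mx !mulmx1 !mul1mx !addr0 ?mul0mx ?add0r.
  congr block_mx.
  by apply/matrixP => i j; rewrite !mxE !ord1 !mulr1n mulr1.
by rewrite -(@rdiag_block R D 1 n (fun=> r) l) XE YD ctrmx_mul -hH !mulmxA.
Qed.
End spectral.

(** * Positive (semi)definite matrices *)

(** Definiteness through the quadratic form, for all three rings at once; it is
stable under sums and congruences, which the eigenvalue condition used over
the quaternions does not show. *)
Definition form_mx (R : realType) (k : scalar_kind) (S : set R) n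
    (X : 'M[Defs.scalar R k]_n) : Prop :=
  hermitian_mx X /\ forall v : 'cV[Defs.scalar R k]_n, v != 0 ->
    exists2 r, S r & ctrmx v *m X *m v = (reals r)%:M.

Notation psd := (form_mx [set r | 0 <= r]).
Notation pd := (form_mx [set r | 0 < r]).

Section semidefinite.
Variables (R : realType) (k : scalar_kind).
Local Notation D := (Defs.scalar R k).

Lemma psd_form n (X : 'M[D]_n) (v : 'cV[D]_n) : psd X ->
  exists2 r, 0 <= r & ctrmx v *m X *m v = (reals r)%:M.
Proof.
move=> [hX pX]; have [->|/pX //] := eqVneq v 0.
by exists 0 => //; rewrite mulmx0 raddf0 raddf0.
Qed.

Lemma psdP n (X : 'M[D]_n) : psd X <-> hermitian_mx X /\
  forall (v : 'cV[D]_n) r, ctrmx v *m X *m v = (reals r)%:M -> 0 <= r.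
Proof.
split.
  move=> pX; split=> [|v r vr]; first by case: pX.
  have [s s0] := psd_form v pX; rewrite vr => /(reals_mx_inj (ltn0Sn 0)).
  by move=> ->.
move=> [hX pX]; split=> // v _; have [r vr] := hermitian_form v hX.
by exists r => //; apply: pX vr.
Qed.

Lemma pd_psd n (X : 'M[D]_n) : pd X -> psd X.
Proof.
by move=> [hX pX]; split=> // v /pX[r r0 E]; exists r => //; exact: ltW.
Qed.

Lemma hermitian_congr m n (T : 'M[D]_(m, n)) (X : 'M[D]_n) : hermitian_mx X ->
  hermitian_mx (T *m X *m ctrmx T).
Proof. by move=> hX; rewrite /hermitian_mx !ctrmx_mul ctrmxK -hX mulmxA. Qed.

Lemma psd_congr m n (T : 'M[D]_(m, n)) (X : 'M[D]_n) : psd X ->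
  psd (T *m X *m ctrmx T).
Proof.
move=> /psdP[hX pX]; apply/psdP; split=> [|v r]; first exact: hermitian_congr.
move=> E; apply: (pX (ctrmx T *m v)).
by rewrite ctrmx_mul ctrmxK -E !mulmxA.
Qed.

Lemma psdD n (X Y : 'M[D]_n) : psd X -> psd Y -> psd (X + Y).
Proof.
move=> pX pY; split=> [|v _].
  by rewrite /hermitian_mx ctrmxD; case: pX pY => <- _ [<- _].
have [r r0 vr] := psd_form v pX; have [s s0 vs] := psd_form v pY.
exists (r + s); first exact: addr_ge0.
by rewrite mulmxDr mulmxDl vr vs !raddfD.
Qed.

Lemma pdD n (X Y : 'M[D]_n) : pd X -> psd Y -> pd (X + Y).
Proof.
move=> pX pY; split=> [|v v0].
  by rewrite /hermitian_mx ctrmxD; case: pX pY => <- _ [<- _].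
have [r r0 vr] := pX.2 v v0; have [s s0 vs] := psd_form v pY.
exists (r + s); first by rewrite /= ltr_wpDr.
by rewrite mulmxDr mulmxDl vr vs !raddfD.
Qed.

Lemma psdZ n r (X : 'M[D]_n) : 0 <= r -> psd X -> psd (reals r *: X).
Proof.
move=> r0 pX; split=> [|v _].
  by rewrite /hermitian_mx ctrmxZ; case: pX => <-.
have [s s0 vs] := psd_form v pX; exists (r * s); first exact: mulr_ge0.
by rewrite mulmxZ -scalemxAl vs realsM -[LHS]mulmx_reals -scalar_mxM reals_comm.
Qed.

Lemma pdZ n r (X : 'M[D]_n) : 0 < r -> pd X -> pd (reals r *: X).
Proof.
move=> r0 pX; split=> [|v v0].
  by rewrite /hermitian_mx ctrmxZ; case: pX => <-.
have [s s0 vs] := pX.2 v v0; exists (r * s); first exact: mulr_gt0.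
by rewrite mulmxZ -scalemxAl vs realsM -[LHS]mulmx_reals -scalar_mxM reals_comm.
Qed.


Lemma pd1 n : pd (1%:M : 'M[D]_n).
Proof.
split=> [|v v0]; first by rewrite /hermitian_mx ctrmx1.
by exists (vsqnorm v); [exact: vsqnorm_gt0|rewrite mulmx1 vsqnormE].
Qed.

Lemma invertible_mulmx_neq0 n (g : 'M[D]_n) (v : 'cV[D]_n) :
  invertible_mx g -> v != 0 -> g *m v != 0.
Proof.
move=> [h [_ hg]] v0; apply: contraNneq v0 => gv.
by rewrite -[v]mul1mx -hg -mulmxA gv mulmx0.
Qed.

Lemma invertible_ctrmx n (g : 'M[D]_n) :
  invertible_mx g -> invertible_mx (ctrmx g).
Proof.
move=> [h [gh hg]]; exists (ctrmx h).
by rewrite -!ctrmx_mul gh hg ctrmx1.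
Qed.

Lemma invertible_mul n (g h : 'M[D]_n) :
  invertible_mx g -> invertible_mx h -> invertible_mx (g *m h).
Proof.
move=> [g' [gg' g'g]] [h' [hh' h'h]]; exists (h' *m g'); split.
  by rewrite mulmxA -(mulmxA g) hh' mulmx1.
by rewrite mulmxA -(mulmxA h') g'g mulmx1.
Qed.

Lemma unitary_invertible n (U : 'M[D]_n) : unitary U -> invertible_mx U.
Proof. by move=> [U1 U2]; exists (ctrmx U). Qed.

Lemma pd_congr n (g X : 'M[D]_n) : invertible_mx g -> pd X ->
  pd (g *m X *m ctrmx g).
Proof.
move=> ig [hX pX]; split=> [|v v0]; first exact: hermitian_congr.
have [r r0 vr] := pX _ (invertible_mulmx_neq0 (invertible_ctrmx ig) v0).
by exists r => //; rewrite -vr ctrmx_mul ctrmxK !mulmxA.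
Qed.

Lemma rdiag_form n (l : 'I_n -> R) (v : 'cV[D]_n) :
  ctrmx v *m rdiag l *m v = (reals (\sum_i l i * sqnorm (v i 0)))%:M.
Proof.
apply/matrixP => i j; rewrite !ord1 !mxE mulr1n rmorph_sum; apply: eq_bigr => a _.
rewrite mul_mx_diag !mxE -(reals_comm (l a)) -mulrA conjs_mul_self.
by rewrite rmorphM.
Qed.

Lemma psd_rdiag n (l : 'I_n -> R) :
  (forall i, 0 <= l i) -> psd (rdiag l : 'M[D]_n).
Proof.
move=> l0; split=> [|v _]; first by rewrite /hermitian_mx ctrmx_rdiag.
rewrite rdiag_form; eexists; last by [].
by apply: sumr_ge0 => i _; rewrite mulr_ge0 ?sqnorm_ge0.
Qed.

Lemma pd_rdiag n (l : 'I_n -> R) :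
  (forall i, 0 < l i) -> pd (rdiag l : 'M[D]_n).
Proof.
move=> l0; split=> [|v v0]; first by rewrite /hermitian_mx ctrmx_rdiag.
rewrite rdiag_form; eexists; last by [].
have l0' i : 0 <= l i * sqnorm (v i 0) by rewrite mulr_ge0 ?sqnorm_ge0 // ltW.
rewrite /= lt_neqAle sumr_ge0 // andbT; apply: contra v0 => /eqP/esym/eqP.
rewrite psumr_eq0 // => /allP h; apply/eqP/colP => i; rewrite mxE; apply: sqnorm_eq0.
apply/eqP; have := h i (mem_index_enum i).
by rewrite mulf_eq0 gt_eqF //=.
Qed.

Lemma rdiag_delta n (l : 'I_n -> R) i :
  rdiag l *m delta_mx i 0 = delta_mx i 0 *m (reals (l i))%:M :> 'cV[D]_n.
Proof.
apply/colP => j; rewrite mul_diag_mx !mxE big_ord1 !mxE mulr1n !eqxx !andbT.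
by case: eqP => [->|_]; rewrite ?mulr1 ?mul1r ?mulr0 ?mul0r.
Qed.

Lemma delta_neq0 n (i : 'I_n) : (delta_mx i 0 : 'cV[D]_n) != 0.
Proof.
by apply/eqP => /colP /(_ i) /eqP; rewrite !mxE !eqxx oner_eq0.
Qed.

Lemma spectral_eigenvalue n (X U : 'M[D]_n) (l : 'I_n -> R) i : unitary U ->
  X = U *m rdiag l *m ctrmx U ->
  U *m delta_mx i 0 != 0 :> 'cV[D]_n /\
  X *m (U *m delta_mx i 0) = U *m delta_mx i 0 *m (reals (l i))%:M :> 'cV[D]_n.
Proof.
move=> UU XE; split.
  exact: invertible_mulmx_neq0 (unitary_invertible UU) (delta_neq0 i).
by rewrite XE -!mulmxA (mulmxA (ctrmx U)) UU.2 mul1mx -rdiag_delta.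
Qed.

Lemma sqnorm0 : sqnorm (0 : D) = 0.
Proof. by rewrite (_ : 0 = reals 0 :> D) ?sqnorm_reals ?expr0n ?raddf0. Qed.

Lemma vsqnorm_delta n (i : 'I_n) : vsqnorm (delta_mx i 0 : 'cV[D]_n) = 1.
Proof.
rewrite /vsqnorm (bigD1 i) //= big1 ?addr0 => [|j ji]; rewrite !mxE ?eqxx ?(negbTE ji) /=.
  by rewrite -(reals1 (R := R)) sqnorm_reals expr1n.
by rewrite sqnorm0.
Qed.

Lemma spectral_form (S : set R) n (X U : 'M[D]_n) (l : 'I_n -> R) : unitary U ->
  X = U *m rdiag l *m ctrmx U -> form_mx S X -> forall i, S (l i).
Proof.
move=> UU XE [_ pX] i; have [v0 Xv] := spectral_eigenvalue i UU XE.
have [r Sr] := pX _ v0; rewrite -mulmxA Xv mulmxA ctrmx_mul.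
rewrite -(mulmxA _ (ctrmx U)) (mulmxA (ctrmx U)) UU.2 mul1mx vsqnormE.
by rewrite vsqnorm_delta reals1 mul1mx => /(reals_mx_inj (ltn0Sn 0)) ->.
Qed.


Lemma spectral_pd n (X : 'M[D]_n) : pd X ->
  exists U (l : 'I_n -> {posnum R}),
    unitary U /\ X = U *m rdiag (fun i => (l i)%:num) *m ctrmx U.
Proof.
move=> pX; have [U [l [UU XE]]] := spectral pX.1.
have l0 := spectral_form UU XE pX.
by exists U, (fun i => PosNum (l0 i)); split.
Qed.

Lemma pd_spectral n (U : 'M[D]_n) (l : 'I_n -> {posnum R}) : invertible_mx U ->
  pd (U *m rdiag (fun i => (l i)%:num) *m ctrmx U).
Proof. by move=> iU; apply: pd_congr iU _; apply: pd_rdiag => i. Qed.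

(** If [X v = v l], then [v^* X v = (v^* v) l], so the form determines the sign
of [l]; conversely the diagonal of the spectral theorem consists of right
eigenvalues. *)
Lemma eigenvalue_form (b : bool) n (X : 'M[D]_n)
    (S := [set r : R | if b then 0 < r else 0 <= r]) :
  (hermitian_mx X /\
   forall l : D, right_eigenvalue X l -> (@reals R D @` S) l) <->
  form_mx S X.
Proof.
split=> [[hX eX]|[hX pX]]; last first.
  split=> // a [v v0 Xv]; have [r Sr] := pX v v0.
  rewrite -mulmxA Xv mulmxA vsqnormE => /matrixP /(_ 0 0).
  rewrite -scalar_mxM !mxE !mulr1n => ar; exists ((vsqnorm v)^-1 * r).
    move: Sr; rewrite /S /=.
    by case: (b); rewrite ?pmulr_rgt0 ?pmulr_rge0 ?invr_gt0 ?vsqnorm_gt0.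
  by rewrite realsM -ar mulrA -realsM mulVf ?reals1 ?mul1r ?gt_eqF ?vsqnorm_gt0.
have [U [l [UU XE]]] := spectral hX.
have Sl i : S (l i).
  have [v0 Xv] := spectral_eigenvalue i UU XE.
  have [r Sr /reals_inj <- //] : (@reals R D @` S) (reals (l i)).
  by apply: eX; exists (U *m delta_mx i 0).
have := UU; rewrite XE => /unitary_invertible iU.
move: Sl; rewrite /S; case: (b) => /= l0.
  exact/pd_congr/pd_rdiag.
exact/psd_congr/psd_rdiag.
Qed.

End semidefinite.

Lemma definite_form (R : realType) (k : scalar_kind) (b : bool) n
    (X : 'M[Defs.scalar R k]_n)
    (S := [set r : R | if b then 0 < r else 0 <= r]) :
  definite_mx S X <-> form_mx S X.
Proof.
have entry (v : 'cV[Defs.scalar R k]_n) :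
    (@reals R (Defs.scalar R k) @` S) ((ctrmx v *m X *m v) 0 0) <->
    exists2 r, S r & ctrmx v *m X *m v = (reals r)%:M.
  split=> -[r Sr E]; exists r => //; last by rewrite E mxE.
  by apply/matrixP => i j; rewrite !ord1 -E mxE.
case: k X @S entry => X S entry; last exact: eigenvalue_form.
  by split=> -[hX pX]; split=> // v /pX /entry.
by split=> -[hX pX]; split=> // v /pX /entry.
Qed.

Lemma posdefE (R : realType) (k : scalar_kind) n
  (X : 'M[Defs.scalar R k]_n) : posdef_mx X <-> pd X.
Proof. exact: (definite_form true). Qed.
Lemma possemidefE (R : realType) (k : scalar_kind) n
  (X : 'M[Defs.scalar R k]_n) : possemidef_mx X <-> psd X.
Proof. exact: (definite_form false). Qed.

(** * Functional calculus and the mean of two matrices *)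

Section calculus.
Variables (R : realType) (k : scalar_kind).
Local Notation D := (Defs.scalar R k).
Implicit Type f : {posnum R} -> {posnum R}.

Definition pdiag n (l : 'I_n -> {posnum R}) : 'M[D]_n :=
  rdiag (fun i => (l i)%:num).

(** Entrywise, [W i j] vanishes unless [l j = m i], and then [f (l j) = f (m i)]. *)
Lemma intertwine n f (W : 'M[D]_n) (l m : 'I_n -> {posnum R}) :
  W *m pdiag l = pdiag m *m W -> W *m pdiag (f \o l) = pdiag (f \o m) *m W.
Proof.
move=> /matrixP WE; apply/matrixP => i j; move: (WE i j).
rewrite !mul_mx_diag !mul_diag_mx !mxE -!(reals_comm _ (W i j)) /= => /eqP.
have [-> //|lm] := eqVneq (l j) (m i).
rewrite -subr_eq0 -mulrBl -raddfB => /eqP E.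
suff -> : W i j = 0 by rewrite !mulr0.
have lm0 : (l j)%:num - (m i)%:num != 0.
  by rewrite subr_eq0; apply: contra lm => /eqP/val_inj ->.
by rewrite -[W i j]mul1r -(reals1 (R := R)) -(mulVf lm0) realsM -mulrA E mulr0.
Qed.

(** [W = H^-1 G] equals [H^* G^*^-1] by the first equation, and then the second
one says that [W] intertwines the two diagonals.  With [G] and [H] unitary
this is the independence of the functional calculus of the diagonalization. *)
Lemma congr_diag_unique n f (G H : 'M[D]_n) (l m : 'I_n -> {posnum R}) :
  invertible_mx G -> invertible_mx H ->
  G *m ctrmx G = H *m ctrmx H ->
  G *m pdiag l *m ctrmx G = H *m pdiag m *m ctrmx H ->
  G *m pdiag (f \o l) *m ctrmx G = H *m pdiag (f \o m) *m ctrmx H.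
Proof.
move=> [G' [GG' G'G]] [H' [HH' H'H]] E1 E2; pose W := H' *m G.
have G1 : ctrmx G *m ctrmx G' = 1%:M by rewrite -ctrmx_mul G'G ctrmx1.
have G2 : ctrmx G' *m ctrmx G = 1%:M by rewrite -ctrmx_mul GG' ctrmx1.
have WE : W = ctrmx H *m ctrmx G'.
  rewrite /W -[G in LHS]mulmx1 -G1 !mulmxA -(mulmxA H') E1.
  by rewrite (mulmxA H') H'H mul1mx.
have /(intertwine f) WL : W *m pdiag l = pdiag m *m W.
  rewrite {2}WE /W -[pdiag l]mulmx1 -G1 !mulmxA.
  rewrite -(mulmxA _ G) -(mulmxA _ (G *m _)) E2.
  by rewrite !mulmxA H'H mul1mx.
transitivity (H *m (W *m pdiag (f \o l)) *m ctrmx G).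
  by rewrite /W !mulmxA HH' mul1mx.
by rewrite WL WE -!mulmxA G2 mulmx1.
Qed.

Lemma pdiag_pd n (G : 'M[D]_n) (l : 'I_n -> {posnum R}) : invertible_mx G ->
  pd (G *m pdiag l *m ctrmx G).
Proof. exact: pd_spectral. Qed.

Lemma fun_calcE n f (U : 'M[D]_n) (l : 'I_n -> {posnum R}) : unitary U ->
  fun_calc f (U *m pdiag l *m ctrmx U) = U *m pdiag (f \o l) *m ctrmx U.
Proof.
move=> UU; apply: xget_unique.
  by exists U, l; case: UU => U1 U2.
move=> Y [V [m [V1 V2 E ->]]].
apply/esym/congr_diag_unique; rewrite ?UU.1 //; first exact: unitary_invertible.
exact: (unitary_invertible (conj V1 V2)).
Qed.

Lemma fun_calc_pd n f (X : 'M[D]_n) : pd X -> pd (fun_calc f X).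
Proof.
move=> /spectral_pd[U [l [UU ->]]]; rewrite (fun_calcE f l UU).
exact: pdiag_pd (unitary_invertible UU).
Qed.

Lemma pd_invertible n (X : 'M[D]_n) : pd X -> invertible_mx X.
Proof.
move=> /spectral_pd[U [l [UU ->]]].
apply: invertible_mul; last exact/unitary_invertible/unitary_ctrmx.
apply: invertible_mul; first exact/unitary_invertible.
exists (rdiag (fun i => ((l i)%:num)^-1)); rewrite !rdiagM -rdiag1.
by split; apply: eq_rdiag => i; rewrite ?mulfV ?mulVf.
Qed.

(** The square root and its inverse, with the equations that the rest of the
proof uses instead of their definition by the functional calculus. *)
Lemma pd_root n (A : 'M[D]_n) : pd A ->
  exists S S',
  [/\ S *m S' = 1%:M, S' *m S = 1%:M, ctrmx S = S, ctrmx S' = S' &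
  [/\ S *m S = A, S = powR_mx 2^-1 A & S' = powR_mx (- 2^-1) A]].
Proof.
move=> /spectral_pd[U [l [UU ->]]]; rewrite /powR_mx.
rewrite !(fun_calcE _ l UU); eexists; eexists; split; last (split; [|by []|by []]).
all: rewrite ?ctrmx_mul ?ctrmxK ?mulmxA ?ctrmx_rdiag //.
- rewrite -(mulmxA _ (ctrmx U)) UU.2 mulmx1 -(mulmxA U) rdiagM.
  rewrite (_ : rdiag _ = 1%:M) ?mulmx1 ?UU.1 // -rdiag1; apply: eq_rdiag => i /=.
  by rewrite powRN mulfV // gt_eqF // powR_gt0.
- rewrite -(mulmxA _ (ctrmx U)) UU.2 mulmx1 -(mulmxA U) rdiagM.
  rewrite (_ : rdiag _ = 1%:M) ?mulmx1 ?UU.1 // -rdiag1; apply: eq_rdiag => i /=.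
  by rewrite powRN mulVf // gt_eqF // powR_gt0.
- rewrite -(mulmxA _ (ctrmx U)) UU.2 mulmx1 -(mulmxA U) rdiagM.
  congr (_ *m _ *m _); apply: eq_rdiag => i /=.
  by rewrite powR12_sqrt // -expr2 sqr_sqrtr.
Qed.

Lemma simultaneous_diag n (A B : 'M[D]_n) : pd A -> pd B ->
  exists G (l : 'I_n -> {posnum R}),
  [/\ invertible_mx G, A = G *m ctrmx G & B = G *m pdiag l *m ctrmx G].
Proof.
move=> /pd_root[S [S' [SS' S'S hS hS' [<- _ _]]]] pB.
have iS : invertible_mx S by exists S'.
have iS' : invertible_mx S' by exists S.
have /spectral_pd[U [l [UU E]]] := pd_congr iS' pB.
exists (S *m U), l; split; first exact/invertible_mul/unitary_invertible.
  by rewrite ctrmx_mul hS mulmxA -(mulmxA S) UU.1 mulmx1.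
rewrite ctrmx_mul hS !mulmxA -(mulmxA S) -(mulmxA S) -/(pdiag l) -E hS'.
by rewrite !mulmxA SS' mul1mx -mulmxA S'S mulmx1.
Qed.

Definition mean_mx f n (A B : 'M[D]_n) : 'M[D]_n :=
  let rA := powR_mx 2^-1 A in let rA' := powR_mx (- 2^-1) A in
  rA *m fun_calc f (rA' *m B *m rA') *m rA.

(** The description of the mean from which its algebraic properties are read off.
The defining formula is the case [G = A^(1/2) U], where [U] diagonalizes
[A^(-1/2) B A^(-1/2)], and [congr_diag_unique] compares any two choices. *)
Lemma mean_mxE f n (G : 'M[D]_n) (l : 'I_n -> {posnum R}) : invertible_mx G ->
  mean_mx f (G *m ctrmx G) (G *m pdiag l *m ctrmx G) =
  G *m pdiag (f \o l) *m ctrmx G.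
Proof.
move=> iG; rewrite /mean_mx.
have pA : pd (G *m ctrmx G) by have := pd_congr iG (pd1 _ _ n); rewrite mulmx1.
have [S [S' [SS' S'S hS hS' [SA <- <-]]]] := pd_root pA.
have iS' : invertible_mx S' by exists S.
have /spectral_pd[U [m [UU E]]] := pd_congr iS' (pdiag_pd l iG).
rewrite hS' in E; rewrite E (fun_calcE f m UU).
have -> : S *m (U *m pdiag (f \o m) *m ctrmx U) *m S =
    (S *m U) *m pdiag (f \o m) *m ctrmx (S *m U).
  by rewrite ctrmx_mul hS !mulmxA.
apply/esym/congr_diag_unique => //.
- by apply: invertible_mul; [exists S'|exact: unitary_invertible].
- by rewrite ctrmx_mul hS !mulmxA -(mulmxA S) UU.1 mulmx1.
rewrite ctrmx_mul hS !mulmxA -(mulmxA S) -(mulmxA S) -/(pdiag m) -E.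
by rewrite !mulmxA SS' mul1mx -[RHS]mulmxA S'S mulmx1.
Qed.
End calculus.

(** * Monotonicity of the mean *)

Section monotone.
Variables (R : realType) (k : scalar_kind).
Local Notation D := (Defs.scalar R k).
Local Notation C := (Defs.scalar R ComplexScalars).
Implicit Type f : {posnum R} -> {posnum R}.

Lemma cmx_pdiag n (l : 'I_n -> {posnum R}) : cmx (pdiag k l) =
  pdiag _ (ord_cat l l).
Proof.
rewrite /pdiag cmx_rdiag; apply: eq_rdiag => i.
by rewrite /ord_cat; case: (fintype.split i).
Qed.

Lemma cmx_congr_diag n (U : 'M[D]_n) (l : 'I_n -> {posnum R}) :
  cmx (U *m pdiag k l *m ctrmx U) =
  cmx U *m pdiag _ (ord_cat l l) *m ctrmx (cmx U).
Proof. by rewrite !cmxM cmx_ctrmx cmx_pdiag. Qed.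

Lemma cmx_pd n (A : 'M[D]_n) : pd A -> pd (cmx A).
Proof.
move=> /spectral_pd[U [l [UU ->]]]; rewrite cmx_congr_diag.
exact/pdiag_pd/unitary_invertible/cmx_unitary.
Qed.

Lemma cmx_fun_calc n f (A : 'M[D]_n) : pd A ->
  cmx (fun_calc f A) = fun_calc f (cmx A).
Proof.
move=> /spectral_pd[U [l [UU ->]]].
rewrite (fun_calcE f l UU) !cmx_congr_diag fun_calcE; last exact: cmx_unitary.
congr (_ *m _ *m _); apply: eq_rdiag => i.
by rewrite /= /ord_cat; case: (fintype.split i).
Qed.

Lemma cmx_psd n (A : 'M[D]_n) : hermitian_mx A -> psd (cmx A) <-> psd A.
Proof.
move=> hA; have [U [l [UU AE]]] := spectral hA.
have cE : cmx A = cmx U *m rdiag (ord_cat l l) *m ctrmx (cmx U).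
  by rewrite AE !cmxM cmx_ctrmx cmx_rdiag.
split=> pA.
  rewrite AE; apply/psd_congr/psd_rdiag => i.
  have := spectral_form (cmx_unitary UU) cE pA (lshift n i).
  by rewrite /ord_cat (unsplitK (inl i)).
rewrite cE; apply/psd_congr/psd_rdiag => i.
by rewrite /ord_cat; case: (fintype.split i) => j; exact: (spectral_form UU AE pA).
Qed.

Lemma cmx_inj m n : injective (@cmx R k m n).
Proof.
move=> A B /eq_block_mx[/matrixP E1 /matrixP E2 _ _]; apply/matrixP => i j.
move: (E1 i j) (E2 i j); rewrite !mxE; case: (k) (A i j) (B i j) => //=.
- by move=> x y [].
- by move=> [a b c d] [a' b' c' d'] /= [-> ->] [-> ->].
Qed.

(** [cmx] reduces this to matrices over a commutative ring, where one-sided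
inverses are two-sided. *)
Lemma right_inverse_invertible n (g h : 'M[D]_n) :
  g *m h = 1%:M -> invertible_mx g.
Proof.
move=> gh; exists h; split=> //; apply: cmx_inj; rewrite cmxM cmx1.
by apply: (@mulmx1C R[i]); rewrite -(@cmxM R k) gh cmx1.
Qed.

(** Operator monotonicity speaks of complex matrices; [cmx] preserves and
reflects the order and commutes with the functional calculus. *)
Lemma fun_calc_monotone f n (A B : 'M[D]_n) :
  (0 < n)%N -> operator_monotone f -> pd A -> pd B -> psd (B - A) ->
  psd (fun_calc f B - fun_calc f A).
Proof.
move=> n0 mf pA pB AB.
have hf : hermitian_mx (fun_calc f B - fun_calc f A).
  have [hB _] := fun_calc_pd f pB; have [hA _] := fun_calc_pd f pA.
  by rewrite /hermitian_mx ctrmxD ctrmxN -hB -hA.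
apply/(cmx_psd hf); rewrite cmxB !cmx_fun_calc //; apply/possemidefE; apply: mf.
- by rewrite addn_gt0 n0.
- exact/posdefE/cmx_pd.
- exact/posdefE/cmx_pd.
- by apply/possemidefE; rewrite -cmxB; apply/cmx_psd => //; case: AB.
Qed.


Section mean.
Variable f : {posnum R} -> {posnum R}.
Local Notation mean := (@mean_mx R k f _).

Lemma mean_pd n (A B : 'M[D]_n) : pd A -> pd B -> pd (mean A B).
Proof.
move=> pA pB; have [G [l [iG -> ->]]] := simultaneous_diag pA pB.
by rewrite mean_mxE //; exact: pdiag_pd.
Qed.

Lemma mean_congr n (g A B : 'M[D]_n) : invertible_mx g -> pd A -> pd B ->
  mean (g *m A *m ctrmx g) (g *m B *m ctrmx g) = g *m mean A B *m ctrmx g.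
Proof.
move=> ig pA pB; have [G [l [iG -> ->]]] := simultaneous_diag pA pB.
rewrite mean_mxE // !mulmxA -(mulmxA g) -!(mulmxA _ (ctrmx G)) -ctrmx_mul mulmxA.
by rewrite -(mulmxA (g *m G)) -ctrmx_mul mean_mxE //; exact: invertible_mul.
Qed.

Lemma scale_congr n (c : R) (A : 'M[D]_n) : 0 < c ->
  let g : 'M[D]_n := (reals (Num.sqrt c))%:M in
  invertible_mx g /\ reals c *: A = g *m A *m ctrmx g.
Proof.
move=> c0 g; have s0 : Num.sqrt c != 0 by rewrite gt_eqF // sqrtr_gt0.
split.
  exists (reals (Num.sqrt c)^-1)%:M.
  by rewrite -!scalar_mxM -!realsM mulfV // mulVf // reals1.
have gE : ctrmx g = g.
  by rewrite /g -scalemx1 ctrmxZ ctrmx1.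
rewrite gE /g mulmx_reals mul_scalar_mx scalerA -realsM -expr2 sqr_sqrtr //.
exact: ltW.
Qed.

Lemma meanZ n (c : R) (A B : 'M[D]_n) : 0 < c -> pd A -> pd B ->
  mean (reals c *: A) (reals c *: B) = reals c *: mean A B.
Proof.
move=> c0 pA pB.
rewrite (scale_congr A c0).2 (scale_congr B c0).2 mean_congr //.
  by rewrite (scale_congr (mean A B) c0).2.
by case: (scale_congr A c0).
Qed.

Lemma mean_block n1 n2 (A B : 'M[D]_n1) (A' B' : 'M[D]_n2) :
  pd A -> pd B -> pd A' -> pd B' ->
  mean (block_mx A 0 0 A') (block_mx B 0 0 B') =
  block_mx (mean A B) 0 0 (mean A' B').
Proof.
move=> pA pB pA' pB'.
have [G [l [iG -> ->]]] := simultaneous_diag pA pB.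
have [G' [l' [iG' -> ->]]] := simultaneous_diag pA' pB'.
rewrite !mean_mxE //.
pose L := ord_cat l l'.
have LE (g : {posnum R} -> {posnum R}) :
    block_mx (pdiag k (g \o l)) 0 0 (pdiag k (g \o l')) = pdiag k (g \o L).
  rewrite /pdiag rdiag_block; apply: eq_rdiag => i.
  by rewrite /= /L /ord_cat; case: (fintype.split i).
have iGG : invertible_mx (block_mx G 0 0 G').
  case: iG iG' => [H [GH HG]] [H' [GH' HG']]; exists (block_mx H 0 0 H').
  rewrite !mulmx_block !mulmx0 !mul0mx !addr0 !add0r GH GH' HG HG'.
  by rewrite -!scalar_mx_block.
have BE (g : {posnum R} -> {posnum R}) :
   block_mx (G *m pdiag k (g \o l) *m ctrmx G) 0
            0 (G' *m pdiag k (g \o l') *m ctrmx G') =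
   block_mx G 0 0 G' *m pdiag k (g \o L) *m ctrmx (block_mx G 0 0 G').
  by rewrite -LE ctrmx_block !ctrmx0 !mulmx_block !mulmx0 !mul0mx !addr0 !add0r ?mul0mx.
have -> : block_mx (G *m ctrmx G) 0 0 (G' *m ctrmx G') =
   block_mx G 0 0 G' *m ctrmx (block_mx G 0 0 G').
  by rewrite ctrmx_block !ctrmx0 !mulmx_block !mulmx0 !mul0mx !addr0 !add0r.
have := BE idfun; rewrite /= => ->; rewrite mean_mxE //.
Qed.

Lemma mean_idem n (A : 'M[D]_n) : f 1%:pos = 1%:pos -> pd A -> mean A A = A.
Proof.
move=> f1 /pd_root[S [S' [SS' S'S hS _ [<- _ _]]]].
have iS : invertible_mx S by exists S'.
pose u : {posnum R} := PosNum (@ltr01 R).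
have fu : f u = u by rewrite (_ : u = 1%:pos) //; apply: val_inj.
have one : pdiag k (fun _ : 'I_n => u) = 1%:M.
  by rewrite -[RHS]rdiag1; apply: eq_rdiag.
have := mean_mxE f (fun=> u) iS.
rewrite (_ : f \o _ = fun=> u); last by apply/funext => i; exact: fu.
by rewrite one mulmx1 hS.
Qed.

(** The mean determines [f] through its values at scalar matrices. *)
Lemma mean1 n (x : {posnum R}) :
  mean 1%:M (reals x%:num)%:M = (reals (f x)%:num)%:M :> 'M[D]_n.
Proof.
have i1 : invertible_mx (1%:M : 'M[D]_n) by exists 1%:M; rewrite mulmx1.
have cE (y : {posnum R}) : pdiag k (fun=> y) = (reals y%:num)%:M :> 'M[D]_n.
  by apply/matrixP => i j; rewrite !mxE.
have := mean_mxE f (fun=> x) i1.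
by rewrite (_ : f \o _ = fun=> f x) // !cE ctrmx1 !mul1mx !mulmx1.
Qed.

Hypothesis mf : operator_monotone f.

Lemma mean_mono_r n (A B B' : 'M[D]_n) : (0 < n)%N -> pd A -> pd B -> pd B' ->
  psd (B' - B) -> psd (mean A B' - mean A B).
Proof.
move=> n0 /pd_root[S [S' [SS' S'S hS hS' [SA SE S'E]]]] pB pB' BB'.
rewrite /mean_mx -SE -S'E -mulmxBl -mulmxBr -{2}hS; apply: psd_congr.
have iS' : invertible_mx S' by exists S.
rewrite -{2 4}hS'.
apply: fun_calc_monotone => //; [exact: pd_congr|exact: pd_congr|].
by rewrite -mulmxBl -mulmxBr; exact: psd_congr.
Qed.

Lemma psd_block_ul n1 n2 (A : 'M[D]_n1) B E (F : 'M[D]_n2) :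
  psd (block_mx A B E F) -> psd A.
Proof.
move=> /(psd_congr (row_mx 1%:M 0)).
rewrite ctrmx_row ctrmx1 ctrmx0 mul_row_block mul_row_col.
by rewrite !mul1mx !mul0mx mulmx1 mulmx0 !addr0.
Qed.

Lemma pd_block_dr n1 n2 (A : 'M[D]_n1) B E (F : 'M[D]_n2) :
  pd (block_mx A B E F) -> pd F.
Proof.
move=> [hX pX]; split=> [|v v0].
  by move: hX; rewrite /hermitian_mx ctrmx_block => /eq_block_mx[].
have v0' : col_mx (0 : 'cV_n1) v != 0.
  by rewrite -col_mx0; apply: contra v0 => /eqP/eq_col_mx[_ ->].
have [r r0 vr] := pX _ v0'; exists r => //; rewrite -vr.
by rewrite ctrmx_col ctrmx0 mul_row_block mul_row_col !mul0mx !add0r mulmx0 add0r.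
Qed.

Lemma pd_block n1 n2 (A : 'M[D]_n1) (B : 'M[D]_n2) :
  pd A -> pd B -> pd (block_mx A 0 0 B).
Proof.
move=> /spectral_pd[U [l [UU ->]]] /spectral_pd[V [m [VV ->]]].
have -> : block_mx (U *m pdiag k l *m ctrmx U) 0 0 (V *m pdiag k m *m ctrmx V) =
    block_mx U 0 0 V *m block_mx (pdiag k l) 0 0 (pdiag k m) *m
    ctrmx (block_mx U 0 0 V).
  rewrite ctrmx_block !ctrmx0 !mulmx_block.
  by rewrite !mulmx0 !mul0mx !addr0 !add0r ?mul0mx.
rewrite rdiag_block; apply: pd_congr.
  exact/unitary_invertible/unitary_block.
by apply: pd_rdiag => i; rewrite /ord_cat; case: (fintype.split i).
Qed.

Lemma inverse_hermitian n (K Ki : 'M[D]_n) :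
  hermitian_mx K -> K *m Ki = 1%:M -> Ki *m K = 1%:M -> ctrmx Ki = Ki.
Proof.
move=> hK K1 K2; rewrite -[RHS]mul1mx -(ctrmx1 D n) -K1 ctrmx_mul -hK -mulmxA K1.
by rewrite mulmx1.
Qed.

(** The block matrix is [L K L^*] for the column [L] of [1] and [- Q^* K^-1]. *)
Lemma schur_psd n1 n2 (K Ki : 'M[D]_n1) (Q : 'M[D]_(n1, n2)) :
  pd K -> K *m Ki = 1%:M -> Ki *m K = 1%:M ->
  psd (block_mx K (- Q) (- ctrmx Q) (ctrmx Q *m Ki *m Q)).
Proof.
move=> pK K1 K2; have hKi := inverse_hermitian pK.1 K1 K2.
have := psd_congr (col_mx 1%:M (- (ctrmx Q *m Ki))) (pd_psd pK).
rewrite ctrmx_col ctrmxN ctrmx1 ctrmx_mul ctrmxK hKi mul_col_mx mul1mx mul_col_row.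
rewrite mulmx1 mulmx1 mulmxN !mulNmx mulmxN opprK !mulmxA K1 mul1mx.
by rewrite -(mulmxA _ Ki K) K2 mulmx1.
Qed.

(** The matrix [g = [[1, 1], [A^-1, - G^-1]]] is invertible because it carries
the direct sum of [A] and [G] to that of [A + G] and [A^-1 + G^-1], which is
again block diagonal.  It carries the direct sum of [Y] and [e Y] to a matrix
with corner [(1 + e) Y], hence below a block diagonal matrix with corner
[(1 + e)^2 Y].  Monotonicity in the second argument, for matrices of twice the
size, compares the means of these pairs; in the corner it says that
[mean A Y + mean G (e Y)] is at most [mean (A + G) ((1 + e)^2 Y)]. *)
Lemma mean_superadditive n (A G Y : 'M[D]_n) (e : R) : (0 < n)%N -> 0 < e ->
  pd A -> pd G -> pd Y ->
  psd (mean (A + G) (reals ((1 + e) ^+ 2) *: Y) - mean A Y).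
Proof.
move=> n0 e0 pA pG pY.
have [Ai [A1 A2]] := pd_invertible pA; have [Gi [G1 G2]] := pd_invertible pG.
have hAi := inverse_hermitian pA.1 A1 A2.
have hGi := inverse_hermitian pG.1 G1 G2.
have iAi : invertible_mx Ai by exists A.
have iGi : invertible_mx Gi by exists G.
have pAi : pd Ai by have := pd_congr iAi pA; rewrite hAi A2 mul1mx.
have pGi : pd Gi by have := pd_congr iGi pG; rewrite hGi G2 mul1mx.
have pS : pd (A + G) := pdD pA (pd_psd pG).
have pSi : pd (Ai + Gi) := pdD pAi (pd_psd pGi).
pose g : 'M[D]_(n + n) := block_mx 1%:M 1%:M Ai (- Gi).
have gE (X X' : 'M[D]_n) : hermitian_mx X -> hermitian_mx X' -> exists Q S,
    g *m block_mx X 0 0 X' *m ctrmx g = block_mx (X + X') Q (ctrmx Q) S.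
  move=> hX hX'; exists (X *m Ai - X' *m Gi), (Ai *m X *m Ai + Gi *m X' *m Gi).
  rewrite /g ctrmx_block !ctrmx1 ctrmxN hAi hGi !mulmx_block.
  rewrite !mulmx0 !mul1mx !addr0 !add0r !mulmx1.
  by rewrite ctrmxD ctrmxN !ctrmx_mul hAi hGi -hX -hX' !mulmxN !mulNmx opprK.
have gAG : g *m block_mx A 0 0 G *m ctrmx g = block_mx (A + G) 0 0 (Ai + Gi).
  rewrite /g ctrmx_block !ctrmx1 ctrmxN hAi hGi !mulmx_block.
  rewrite !mulmx0 !mul1mx !addr0 !add0r !mulmx1.
  by rewrite !(mulmxN, mulNmx) G1 G2 A1 A2 subrr !mul1mx opprK.
have pAG : pd (block_mx (A + G) 0 0 (Ai + Gi)) by exact: pd_block.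
have ig : invertible_mx g.
  have [h [ph _]] := pd_invertible pAG.
  apply: (@right_inverse_invertible _ _ (block_mx A 0 0 G *m ctrmx g *m h)).
  by rewrite !mulmxA gAG ph.
have peY : pd (reals e *: Y) by exact: pdZ.
have [Q [S gY]] := gE Y (reals e *: Y) pY.1 peY.1.
pose M := block_mx (Y + reals e *: Y) Q (ctrmx Q) S; rewrite -/M in gY.
have pM : pd M by rewrite -gY; apply: pd_congr ig _; exact: pd_block.
have YE : Y + reals e *: Y = reals (1 + e) *: Y.
  by rewrite realsD reals1 scalerDl scale1r.
(* The excess of [(1 + e)^2 Y] over [(1 + e) Y], the corner of [M]: it absorbs
   the off-diagonal block [Q] at the price of the Schur complement [T]. *)
pose K := reals (e * (1 + e)) *: Y.
have e1 : 0 < 1 + e by rewrite ltr_wpDr // ltW.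
have pK : pd K by apply: pdZ => //; exact: mulr_gt0.
have [Ki [K1 K2]] := pd_invertible pK.
have pMN := schur_psd Q pK K1 K2.
pose T := ctrmx Q *m Ki *m Q.
pose N := block_mx (reals ((1 + e) ^+ 2) *: Y) 0 0 (S + T).
have NM : N = M + block_mx K (- Q) (- ctrmx Q) T.
  rewrite /M add_block_mx !subrr YE; congr block_mx.
  by rewrite /K -scalerDl -raddfD /=; congr (reals _ *: _); ring.
have pN : pd N by rewrite NM; exact: pdD.
have pST : pd (S + T) := pd_block_dr pN.
have pcY : pd (reals ((1 + e) ^+ 2) *: Y) by apply: pdZ; rewrite ?exprn_gt0.
have pbAG : pd (block_mx A 0 0 G) by exact: pd_block.
have pbY : pd (block_mx Y 0 0 (reals e *: Y)) by exact: pd_block.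
have : psd (mean (block_mx (A + G) 0 0 (Ai + Gi)) N -
            mean (block_mx (A + G) 0 0 (Ai + Gi)) M).
  apply: mean_mono_r => //; first by rewrite addn_gt0 n0.
  by rewrite NM addrC addKr.
rewrite -{2}gAG -gY (mean_congr ig pbAG pbY) /N !mean_block //.
have [Q' [S' ->]] := gE (mean A Y) (mean G (reals e *: Y))
  (mean_pd pA pY).1 (mean_pd pG peY).1.
rewrite opp_block_mx add_block_mx => /psd_block_ul h.
have := psdD h (pd_psd (mean_pd pG peY)).
by rewrite opprD addrA subrK.
Qed.

Lemma psd_of_scaled_psd n (X Y : 'M[D]_n) : psd X -> hermitian_mx Y ->
  (forall c, 1 < c -> psd (reals c *: X - Y)) -> psd (X - Y).
Proof.
move=> pX hY h; split=> [|v _].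
  by rewrite /hermitian_mx ctrmxD ctrmxN -hY; case: pX => <-.
have [x x0 vx] := psd_form v pX; have [y vy] := hermitian_form v hY.
exists (x - y); last by rewrite mulmxBr mulmxBl vx vy !raddfB.
rewrite /= subr_ge0; apply/ler_addgt0Pr => e e0.
have c1 : 1 < 1 + e / (1 + x) by rewrite ltrDl divr_gt0 // ltr_wpDr.
have [r r0] := psd_form v (h _ c1).
rewrite mulmxBr mulmxBl vy mulmxZ -scalemxAl vx -mulmx_reals -scalar_mxM.
rewrite -realsM -!raddfB.
move=> /(reals_mx_inj (ltn0Sn 0)) E; rewrite -E subr_ge0 in r0.
apply: le_trans r0 _.
rewrite mulrDr mulr1 lerD2l mulrCA ger_pMr // ler_pdivrMr ?ltr_wpDr // mul1r.
by rewrite lerDr.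
Qed.

(** For [c > 1], the difference [c B - A] is positive definite, so superadditivity
bounds [mean A Y] by [mean (c B) (c Y) = c mean B Y]; then let [c] tend to 1. *)
Lemma mean_mono_l n (A B Y : 'M[D]_n) : (0 < n)%N -> pd A -> pd B -> pd Y ->
  psd (B - A) -> psd (mean B Y - mean A Y).
Proof.
move=> n0 pA pB pY AB; apply: psd_of_scaled_psd.
- exact/pd_psd/mean_pd.
- exact: (mean_pd pA pY).1.
move=> c c1; have c0 : 0 < c by apply: lt_trans c1.
rewrite -meanZ //; pose e := Num.sqrt c - 1.
have e0 : 0 < e by rewrite subr_gt0 -(sqrtr1 R) ltr_sqrt.
have ec : (1 + e) ^+ 2 = c by rewrite /e addrC subrK sqr_sqrtr //; exact: ltW.
have pG : pd (reals c *: B - A).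
  rewrite -[c](subrK 1) realsD scalerDl reals1 scale1r -addrA.
  by apply: pdD => //; apply: pdZ => //; rewrite subr_gt0.
have := mean_superadditive n0 e0 pA pG pY.
by rewrite ec (addrC A) subrK.
Qed.

End mean.
End monotone.

(** * Continuity of the mean *)

Section continuity.
Variables (R : realType) (k : scalar_kind).
Local Notation D := (Defs.scalar R k).

Lemma finite_lower_bound (T : finType) (F : T -> R) : (forall i, 0 < F i) ->
  exists2 c, 0 < c & forall i, c <= F i.
Proof.
move=> F0; exists (\big[Num.min/1]_i F i).
  by elim/big_ind: _ => // x y x0 y0; rewrite lt_min x0.
by move=> i; rewrite (bigD1 i) //= ge_min lexx.
Qed.

Lemma nbhs_mxP m n (M : 'M[D]_(m, n)) (A : set 'M[D]_(m, n)) :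
  nbhs M A <-> exists2 e : R, 0 < e &
    forall N : 'M[D]_(m, n), (forall i j, sqnorm (N i j - M i j) < e) -> A N.
Proof.
split.
  case=> P nP PA.
  have /choice[E EP] (ij : 'I_m * 'I_n) : exists e, 0 < e /\
      forall y, sqnorm (y - M ij.1 ij.2) < e -> P ij.1 ij.2 y.
    by have /nbhs_scalarP[e e0 eP] := nP ij.1 ij.2; exists e.
  have [e e0 eE] := @finite_lower_bound _ E (fun ij => (EP ij).1).
  exists e => // N NM; apply: PA => i j; apply: (EP (i, j)).2 => /=.
  exact: lt_le_trans (NM i j) (eE _).
case=> e e0 eA; exists (fun i j => [set y | sqnorm (y - M i j) < e]).
  by move=> i j; apply/nbhs_scalarP; exists e.
by move=> N NM; apply: eA.
Qed.

Lemma psd_trans n (X Y Z : 'M[D]_n) : psd (Y - X) -> psd (Z - Y) -> psd (Z - X).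
Proof. by move=> XY YZ; have := psdD YZ XY; rewrite addrA subrK. Qed.

Lemma sqnormD (x y : D) : sqnorm (x + y) <= 2 * sqnorm x + 2 * sqnorm y.
Proof.
suff E : sqnorm (x + y) + sqnorm (x - y) = 2 * sqnorm x + 2 * sqnorm y.
  by rewrite -E lerDl sqnorm_ge0.
case: (k) x y => [x y|[a b] [a' b']|[a b c d] [a' b' c' d']] /=; ring.
Qed.

(** A crude stand-in for the Cauchy-Schwarz inequality, by iterating the
parallelogram bound; only some constant depending on [n] matters below. *)
Lemma sqnorm_sum n (x : 'I_n -> D) :
  sqnorm (\sum_i x i) <= 2 ^+ n * \sum_i sqnorm (x i).
Proof.
elim: n x => [|n IHn] x; first by rewrite !big_ord0 sqnorm0 mulr0.
rewrite !big_ord_recl exprS; apply: le_trans (sqnormD _ _) _.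
rewrite -mulrA mulrDr -[in leRHS]mulrDr -mulrDr ler_pM2l // mulrDr lerD ?IHn //.
by rewrite ler_peMl ?sqnorm_ge0 // exprn_ege1 // ler1n.
Qed.

Lemma scalar_sub_diag n (U : 'M[D]_n) a (l : 'I_n -> R) : unitary U ->
  (reals a)%:M - U *m rdiag l *m ctrmx U = U *m rdiag (fun i => a - l i) *m ctrmx U.
Proof.
move=> UU; have -> : rdiag (fun i => a - l i) = (reals a)%:M - rdiag l :> 'M[D]_n.
  by apply/matrixP => i j; rewrite !mxE raddfB mulrnBl.
by rewrite mulmxBr mulmxBl mulmx_reals -scalemxAl UU.1 scalemx1.
Qed.

Lemma congr_diagN n (U : 'M[D]_n) (l : 'I_n -> R) :
  U *m rdiag (fun i => - l i) *m ctrmx U = - (U *m rdiag l *m ctrmx U).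
Proof.
have -> : rdiag (fun i => - l i) = - rdiag l :> 'M[D]_n.
  by apply/matrixP => i j; rewrite !mxE raddfN mulNrn.
by rewrite mulmxN mulNmx.
Qed.

(** For a unit eigenvector [v] of eigenvalue [l], [l^2] is the squared norm of
[H v], which the entries of [H] control. *)
Lemma hermitian_scalar_bound n (H : 'M[D]_n) t : 0 <= t -> hermitian_mx H ->
  (forall i j, 2 ^+ n * n%:R * sqnorm (H i j) <= t ^+ 2) ->
  psd ((reals t)%:M - H) /\ psd ((reals t)%:M + H).
Proof.
move=> t0 hH Ht; have [U [l [UU HE]]] := spectral hH.
have lt i : `|l i| <= t.
  have [v0 Hv] := spectral_eigenvalue i UU HE; set v := U *m _ in v0 Hv.
  have vE j : sqnorm (v j 0) * l i ^+ 2 = sqnorm (\sum_a H j a * v a 0).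
    have /colP/(_ j) := Hv; rewrite !mxE big_ord1 !mxE mulr1n => ->.
    by rewrite sqnormM sqnorm_reals.
  have : vsqnorm v * l i ^+ 2 <= vsqnorm v * t ^+ 2.
    rewrite /vsqnorm mulr_suml (eq_bigr _ (fun j _ => vE j)).
    apply: (@le_trans _ _ (\sum_(j < n) \sum_(a < n)
      2 ^+ n * (sqnorm (H j a) * sqnorm (v a 0)))).
      apply: ler_sum => j _; apply: le_trans (sqnorm_sum _) _.
      by rewrite mulr_sumr; apply: ler_sum => a _; rewrite sqnormM.
    rewrite exchange_big /= mulr_suml; apply: ler_sum => a _.
    have -> : sqnorm (v a 0) * t ^+ 2 = \sum_(j < n) sqnorm (v a 0) * t ^+ 2 / n%:R.
      rewrite sumr_const card_ord -[RHS]mulr_natr mulfVK // pnatr_eq0 -lt0n.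
      exact: leq_ltn_trans (ltn_ord i).
    apply: ler_sum => j _; rewrite mulrA mulrC -mulrA ler_wpM2l ?sqnorm_ge0 //.
    rewrite ler_pdivlMr; last by rewrite ltr0n (leq_ltn_trans _ (ltn_ord i)).
    by rewrite mulrAC.
  rewrite ler_pM2l ?vsqnorm_gt0 // -(real_normK (num_real (l i))).
  by rewrite ler_pXn2r // nnegrE.
have lm i := le_trans (ler_norm _) (lt i).
have lp i : 0 <= t - (- l i).
  by rewrite subr_ge0; apply: le_trans (lt i); rewrite -normrN ler_norm.
have HN : - H = U *m rdiag (fun i => - l i) *m ctrmx U.
  by rewrite HE; apply/esym; exact: congr_diagN.
split; last rewrite -[X in _ + X]opprK HN; last first.
  by rewrite scalar_sub_diag //; apply/psd_congr/psd_rdiag.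
by rewrite HE scalar_sub_diag //; apply/psd_congr/psd_rdiag => i; rewrite subr_ge0.
Qed.

(** The eigenvalues of [K] lie in [[-t, t]], so [K^* K] is at most [t^2], and its
diagonal entries are the squared norms of the columns of [K]. *)
Lemma entry_bound n (K : 'M[D]_n) t :
  psd ((reals t)%:M - K) -> psd ((reals t)%:M + K) ->
  forall i j, sqnorm (K i j) <= t ^+ 2.
Proof.
move=> p1 p2 i j.
have hK : hermitian_mx K.
  have := p2.1; have tt : ctrmx (reals t)%:M = (reals t)%:M :> 'M[D]_n.
    by rewrite -scalemx1 ctrmxZ ctrmx1.
  by rewrite /hermitian_mx ctrmxD tt => /addrI.
have [U [l [UU KE]]] := spectral hK.
have lt a : `|l a| <= t.
  rewrite ler_norml; apply/andP; split.
    have E : (reals t)%:M + K = U *m rdiag (fun a => t - (- l a)) *m ctrmx U.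
      by rewrite -scalar_sub_diag // congr_diagN -KE opprK.
    have /= := spectral_form UU E p2 a.
    by rewrite opprK -{1}[l a]opprK subr_ge0 lerNl.
  have E : (reals t)%:M - K = U *m rdiag (fun a => t - l a) *m ctrmx U.
    by rewrite -scalar_sub_diag // -KE.
  by have /= := spectral_form UU E p1 a; rewrite subr_ge0.
have : psd (U *m rdiag (fun a => t ^+ 2 - l a * l a) *m ctrmx U).
  apply/psd_congr/psd_rdiag => a.
  rewrite subr_ge0 -expr2 -(real_normK (num_real (l a))).
  by rewrite ler_pXn2r // ?nnegrE ?normr_ge0 //; exact: le_trans (lt a).
have KK : ctrmx K *m K = U *m rdiag (fun a => l a * l a) *m ctrmx U.
  rewrite -hK {1 2}KE !mulmxA -(mulmxA _ (ctrmx U) U) UU.2 mulmx1.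
  by rewrite -(mulmxA U) rdiagM.
rewrite -scalar_sub_diag // -KK.
move=> /psdP[_ /(_ (delta_mx j 0) (t ^+ 2 - vsqnorm (col j K)))].
rewrite mulmxBr mulmxBl mulmx_reals -scalemxAl vsqnormE vsqnorm_delta reals1.
rewrite !mulmxA -ctrmx_mul -mulmxA -!colE vsqnormE.
rewrite raddfB raddfB /= scalemx1 => /(_ erefl).
rewrite subr_ge0; apply: le_trans; rewrite /vsqnorm (bigD1 i) //= mxE lerDl.
by apply: sumr_ge0 => a _; exact: sqnorm_ge0.
Qed.
End continuity.

Section mean_continuity.
Variables (R : realType) (k : scalar_kind).
Local Notation D := (Defs.scalar R k).

Lemma realsB (a b : R) : reals (a - b) = reals a - reals b :> D.
Proof. exact: raddfB. Qed.

Lemma pd_lower_bound n (A : 'M[D]_n) : pd A ->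
  exists2 c, 0 < c & psd (A - (reals c)%:M).
Proof.
move=> /spectral_pd[U [l [UU AE]]].
have [c c0 cl] := finite_lower_bound (fun i => gt0 (l i)).
exists c => //; rewrite -[X in psd X]opprK opprB AE scalar_sub_diag // -congr_diagN.
by apply/psd_congr/psd_rdiag => i; rewrite opprB subr_ge0.
Qed.

Lemma pd_upper_bound n (A : 'M[D]_n) : pd A ->
  exists2 c, 0 < c & psd ((reals c)%:M - A).
Proof.
move=> /spectral_pd[U [l [UU AE]]].
exists (1 + \sum_i (l i)%:num); first by rewrite ltr_wpDr // sumr_ge0.
rewrite AE scalar_sub_diag //; apply/psd_congr/psd_rdiag => i.
rewrite subr_ge0 (bigD1 i) //= addrCA lerDl addr_ge0 //.
by apply: sumr_ge0.
Qed.

(** With [m] below the spectrum of [A0], an entrywise small Hermitian difference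
is at most [(1 - 1/c) m], hence at most [(1 - 1/c) A0], in the operator order. *)
Lemma nbhs_order_interval n (A0 : 'M[D]_n) c : 1 < c -> pd A0 ->
  exists2 d, 0 < d & forall A, hermitian_mx A ->
    (forall i j, sqnorm (A i j - A0 i j) < d) ->
    psd (reals c *: A0 - A) /\ psd (reals c *: A - A0).
Proof.
move=> c1 pA0; have [m m0 mA] := pd_lower_bound pA0.
have c0 : 0 < c by apply: lt_trans c1.
pose e := 1 - c^-1.
have e0 : 0 < e by rewrite subr_gt0 invf_lt1.
have ce : c * e = c - 1 by rewrite mulrBr mulr1 mulfV // gt_eqF.
pose t := e * m; have t0 : 0 < t by exact: mulr_gt0.
pose N : R := 2 ^+ n * n%:R.
have N0 : 0 <= N by rewrite mulr_ge0 // exprn_ge0.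
have N1 : 0 < N + 1 by rewrite ltr_wpDl.
exists (t ^+ 2 / (N + 1)); first by rewrite divr_gt0 // exprn_gt0.
move=> A hA AA; pose H := A - A0.
have AE : A = A0 + H by rewrite addrC subrK.
have hH : hermitian_mx H by rewrite /hermitian_mx ctrmxD ctrmxN -hA -pA0.1.
have Ht i j : 2 ^+ n * n%:R * sqnorm (H i j) <= t ^+ 2.
  rewrite -/N; have := AA i j; rewrite !mxE ltr_pdivlMr // mulrDr mulr1 mulrC => /ltW.
  by apply: le_trans; rewrite lerDl sqnorm_ge0.
have [p1 p2] := hermitian_scalar_bound (ltW t0) hH Ht.
have emA : psd (reals e *: A0 - (reals t)%:M).
  have := psdZ (ltW e0) mA; rewrite scalerBr -[(reals m)%:M]scalemx1 scalerA -realsM.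
  by rewrite -/t scalemx1.
have eP : psd (reals e *: A0 + H) by have := psdD emA p2; rewrite addrA subrK.
have eN : psd (reals e *: A0 - H) by have := psdD emA p1; rewrite addrA subrK.
split.
  have -> : reals c *: A0 - A = reals ((c - 1) - e) *: A0 + (reals e *: A0 - H).
    rewrite addrA -scalerDl -realsD subrK realsB scalerBl reals1 scale1r AE opprD.
    by rewrite addrA.
  apply: psdD => //; apply: psdZ; last exact: pd_psd.
  by rewrite -ce subr_ge0 ler_peMl // ltW.
have -> : reals c *: A - A0 = reals c *: (reals e *: A0 + H).
  rewrite AE !scalerDr scalerA -realsM ce realsB scalerBl reals1 scale1r.
  by rewrite addrAC.
exact: psdZ (ltW c0) _.
Qed.

(** Together with [nbhs_order_interval]: the topology of the positive definite
matrices is generated by the order intervals [[A0 / c, c A0]]. *)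
Lemma order_interval_nbhs n (M0 : 'M[D]_n) d : 0 < d -> pd M0 ->
  exists2 c, 1 < c & forall M,
    psd (reals c *: M0 - M) -> psd (reals c *: M - M0) ->
    forall i j, sqnorm (M i j - M0 i j) < d.
Proof.
move=> d0 pM0; have [C C0 MC] := pd_upper_bound pM0.
pose s := Num.sqrt d / 2.
have s0 : 0 < s by rewrite divr_gt0 // sqrtr_gt0.
have sd : s ^+ 2 < d.
  rewrite exprMn sqr_sqrtr ?ltW // gtr_pMr // exprVn invf_lt1 ?exprn_gt0 //.
  by rewrite expr2 -natrM ltr1n.
pose e := Num.min 1 (s / (2 * C)).
have e0 : 0 < e by rewrite lt_min ltr01 divr_gt0 // mulr_gt0.
have e1 : e <= 1 by rewrite ge_min lexx.
have es : 2 * e * C <= s.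
  rewrite mulrAC mulrC -ler_pdivlMr ?mulr_gt0 //.
  by rewrite ge_min lexx orbT.
exists (1 + e); first by rewrite ltrDl.
move=> M p1 p2 i j; pose K := M - M0.
have scal (a : R) (X : 'M[D]_n) :
    0 <= a -> 2 * e * C >= a * C -> psd (reals a *: M0 + X) ->
    psd ((reals (2 * e * C))%:M + X).
  move=> a0 ae pX; have := psdD (psdZ a0 MC) pX.
  have -> : reals a *: ((reals C)%:M - M0) + (reals a *: M0 + X) =
      (reals (a * C))%:M + X.
    by rewrite scalerBr addrA subrK -[(reals C)%:M]scalemx1 scalerA -realsM scalemx1.
  move=> pY; have := psdD (psdZ (_ : 0 <= 2 * e * C - a * C) (pd_psd (pd1 R k n))) pY.
  rewrite subr_ge0 scalemx1 addrA -raddfD -raddfD /= subrK; exact.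
have tK : psd ((reals (2 * e * C))%:M - K).
  apply: (scal e); rewrite ?(ltW e0) //.
    by rewrite ler_pM2r // ler_peMl ?ler1n // ltW.
  by move: p1; rewrite realsD reals1 scalerDl scale1r (addrC M0) -addrA /K opprB.
have tK' : psd ((reals (2 * e * C))%:M + K).
  apply: (scal (e * (1 + e))).
  - by rewrite mulr_ge0 ?addr_ge0 // ltW.
  - rewrite ler_pM2r // mulrC ler_pM2r //; lra.
  have := psdD p2 (psdZ (ltW e0) p1).
  rewrite scalerBr scalerA -realsM (realsD 1 e) reals1 scalerDl scale1r /K => h.
  have -> : reals (e * (1 + e)) *: M0 + (M - M0) =
      M + reals e *: M - M0 + (reals (e * (1 + e)) *: M0 - reals e *: M).
    rewrite [in RHS](addrAC M) -[RHS]addrA (addrCA (reals e *: M)) subrr.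
    by rewrite addr0 addrC.
  exact: h.
have := entry_bound tK tK' i j; rewrite !mxE => /le_lt_trans; apply.
apply: le_lt_trans sd; have s0' := ltW s0.
by rewrite ler_pXn2r // nnegrE mulr_ge0 ?mulr_ge0 // ltW.
Qed.

Local Notation P n := (@posdef_mx R k n).

Lemma mean_posdef f n (A B : P n) : P n (mean_mx f (set_val A) (set_val B)).
Proof.
by apply/posdefE; apply: mean_pd; apply/posdefE; apply: set_mem; exact: valP.
Qed.

Definition mean f n (A B : P n) : P n := SigSub (mem_set (mean_posdef f A B)).

Lemma mean_val f n (A B : P n) :
  set_val (mean f A B) = mean_mx f (set_val A) (set_val B).
Proof. by []. Qed.

Lemma setval_pd n (A : P n) : pd (set_val A).
Proof. apply/posdefE; apply: set_mem; exact: valP. Qed.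

(** Continuity follows from monotonicity and homogeneity alone: if [A] and [B]
lie between [A0 / c], [c A0] and [B0 / c], [c B0], then their mean lies
between [1 / c] and [c] times that of [A0] and [B0]. *)
Lemma mean_kubo_ando f n : (0 < n)%N -> normalized_operator_monotone f ->
  kubo_ando_mean (@mean f n).
Proof.
move=> n0 [f1 mf].
have mono (A B C E : 'M[D]_n) : pd A -> pd B -> pd C -> pd E ->
    psd (B - A) -> psd (E - C) ->
    psd (mean_mx f B E - mean_mx f A C).
  move=> pA pB pC pE AB CE; apply: (@psd_trans _ _ _ _ (mean_mx f A E)).
    exact: mean_mono_r.
  exact: mean_mono_l.
split.
- move=> [A0 B0] W /= /(nbhs_initialP (f := set_val)) [V nV VW].
  have [d d0 dV] := (nbhs_mxP _ _).1 nV.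
  have [c c1 cV] := order_interval_nbhs d0 (setval_pd (mean f A0 B0)).
  have [dA dA0 hA] := nbhs_order_interval c1 (setval_pd A0).
  have [dB dB0 hB] := nbhs_order_interval c1 (setval_pd B0).
  exists ([set A : P n | forall i j,
             sqnorm (set_val A i j - set_val A0 i j) < dA],
          [set B : P n | forall i j,
             sqnorm (set_val B i j - set_val B0 i j) < dB]).
    split; apply/(nbhs_initialP (f := set_val)).
      exists [set A : 'M[D]_n | forall i j,
        sqnorm (A i j - set_val A0 i j) < dA] => //.
      by apply/nbhs_mxP; exists dA.
    exists [set B : 'M[D]_n | forall i j,
      sqnorm (B i j - set_val B0 i j) < dB] => //.
    by apply/nbhs_mxP; exists dB.
  move=> [A B] /= [nA nB]; apply: VW; apply: dV; apply: cV => /=.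
    have [A1 _] := hA _ (setval_pd A).1 nA.
    have [B1 _] := hB _ (setval_pd B).1 nB.
    have c0 : 0 < c by apply: lt_trans c1.
    rewrite -meanZ //; [apply: mono => //; try apply: pdZ => // | | ];
      exact: setval_pd.
  have [_ A1] := hA _ (setval_pd A).1 nA.
  have [_ B1] := hB _ (setval_pd B).1 nB.
  have c0 : 0 < c by apply: lt_trans c1.
  rewrite -meanZ //; [apply: mono => //; try apply: pdZ => // | | ];
      exact: setval_pd.
- move=> A B C E /possemidefE AB /possemidefE CE; apply/possemidefE.
  by apply: mono => //; exact: setval_pd.
- move=> g A B gA gB ig gAE gBE.
  by rewrite !mean_val gAE gBE mean_congr //; exact: setval_pd.
- move=> I IE; apply: val_inj; have /= := mean_idem f1 (setval_pd I); exact.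
Qed.
End mean_continuity.

(** * Transport along multiplication by J *)

Lemma continuous_conjugate (T T' : topologicalType) (a : T -> T') (b : T' -> T)
    (s : T' -> T' -> T') :
  continuous a -> continuous b -> continuous (fun z : T' * T' => s z.1 z.2) ->
  continuous (fun z : T * T => b (s (a z.1) (a z.2))).
Proof.
move=> ca cb cs z.
apply: (@continuous_comp _ _ _ (fun z : T * T => s (a z.1) (a z.2)) b);
  last exact: cb.
apply: (@continuous_comp _ _ _ (fun z : T * T => (a z.1, a z.2))
  (fun w : T' * T' => s w.1 w.2)); last exact: cs.
apply: cvg_pair => /=.
  by apply: continuous_comp; [exact: cvg_fst|exact: ca].
by apply: continuous_comp; [exact: cvg_snd|exact: ca].
Qed.

Section transport.
Variables (R : realType) (k : scalar_kind) (p q : nat).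
Local Notation D := (Defs.scalar R k).
Local Notation n := (p + q)%N.
Local Notation P := (@posdef_mx R k n).
Local Notation PJ := (@J_posdef_mx R k p q).
Local Notation J := (Jmx R k p q).

Lemma from_PJ_val (X : PJ) : set_val (from_PJ X) = J *m set_val X.
Proof. by []. Qed.

Lemma to_PJ_val (X : P) : set_val (to_PJ X) = J *m set_val X.
Proof. by []. Qed.

Lemma mulJK (X : 'M[D]_n) : J *m (J *m X) = X.
Proof. by rewrite mulmxA mulJJ mul1mx. Qed.

Lemma from_PJK : cancel (@from_PJ R k p q) (@to_PJ R k p q).
Proof. by move=> X; apply: val_inj; exact: mulJK. Qed.
Lemma to_PJK : cancel (@to_PJ R k p q) (@from_PJ R k p q).
Proof. by move=> X; apply: val_inj; exact: mulJK. Qed.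

(** Multiplication by [J] only changes signs of entries, hence is continuous. *)
Lemma sqnorm_mulJ (X : 'M[D]_n) i j : sqnorm ((J *m X) i j) = sqnorm (X i j).
Proof.
rewrite -{1}[X]vsubmxK mul_block_col !mul1mx !mul0mx addr0 add0r mulNmx mul1mx.
have -> : X i j = col_mx (usubmx X) (dsubmx X) i j by rewrite vsubmxK.
rewrite [X in sqnorm X = _]mxE [X in _ = sqnorm X]mxE; case: (fintype.split i) => a //.
by rewrite [X in sqnorm X = _]mxE sqnormN.
Qed.

Lemma mulJ_continuous (A B : set 'M[D]_n) (f : A -> B) :
  (forall X, set_val (f X) = J *m set_val X) -> continuous f.
Proof.
move=> fE X W /(nbhs_initialP (f := set_val)) [V /nbhs_mxP[e e0 eV] VW].
apply/(nbhs_initialP (f := set_val)).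
exists [set Y : 'M[D]_n | forall i j, sqnorm (Y i j - set_val X i j) < e].
  by apply/nbhs_mxP; exists e.
move=> Y YX; apply: VW; apply: eV => i j; rewrite !fE.
have -> : (J *m set_val Y) i j - (J *m set_val X) i j =
    (J *m (set_val Y - set_val X)) i j.
  by rewrite mulmxBr !mxE.
by rewrite sqnorm_mulJ !mxE.
Qed.

Definition J_mean (s : P -> P -> P) : PJ -> PJ -> PJ :=
  fun X Y => to_PJ (s (from_PJ X) (from_PJ Y)).



Lemma J_mean_kubo_ando (s : P -> P -> P) :
  kubo_ando_mean s -> J_kubo_ando_mean (J_mean s).
Proof.
move=> [sc sm sg s1]; split.
- by apply: (continuous_conjugate (s := s)) => //; apply: mulJ_continuous => X.
- move=> A B C E AB CE; rewrite /J_le !to_PJ_val !mulJK.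
  exact: sm.
- move=> g A B gA gB ig gAE gBE; rewrite !to_PJ_val.
  have := sg (ctrmx g) (from_PJ A) (from_PJ B) (from_PJ gA) (from_PJ gB).
  rewrite !from_PJ_val gAE gBE /sharp ctrmxK !mulmxA mulJJ !mul1mx => <- //.
    by rewrite !mulmxA -(mulmxA _ J J) mulJJ mulmx1.
  exact: invertible_ctrmx.
- move=> JJ JE; rewrite -[RHS]from_PJK /J_mean; congr to_PJ; apply: s1.
  by rewrite from_PJ_val JE mulJJ.
Qed.

Lemma associated_kubo_ando (sJ : PJ -> PJ -> PJ) :
  J_kubo_ando_mean sJ -> kubo_ando_mean (associated_mean sJ).
Proof.
move=> [sc sm sg s1]; split.
- by apply: (continuous_conjugate (s := sJ)) => //; apply: mulJ_continuous => X.
- move=> A B C E AB CE; rewrite /associated_mean !from_PJ_val; apply: sm;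
    by rewrite /J_le !to_PJ_val !mulJK.
- move=> g A B gA gB ig gAE gBE; rewrite !from_PJ_val.
  have := sg (ctrmx g) (to_PJ A) (to_PJ B) (to_PJ gA) (to_PJ gB).
  rewrite !to_PJ_val gAE gBE /sharp ctrmxK => <- //.
  + by rewrite !mulmxA mulJJ mul1mx.
  + exact: invertible_ctrmx.
  + by rewrite !mulmxA -(mulmxA _ J J) mulJJ mulmx1.
  + by rewrite !mulmxA -(mulmxA _ J J) mulJJ mulmx1.
- move=> I IE; rewrite -[RHS]to_PJK /associated_mean; congr from_PJ; apply: s1.
  by rewrite to_PJ_val IE mulmx1.
Qed.

(** Each [bullet] inserts a factor [J] that cancels against one of [J_pow] or
[J_fun]. *)
Lemma J_mean_formulaE (sJ : PJ -> PJ -> PJ) f :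
  J_mean_formula sJ f <->
  forall A B : PJ,
    set_val (sJ A B) = J *m mean_mx f (J *m set_val A) (J *m set_val B).
Proof.
have E (A B : PJ) :
  let rA := J_pow 2^-1 (set_val A) in
  let rA' := J_pow (- 2^-1) (set_val A) in
  bullet (bullet rA (J_fun f (bullet (bullet rA' (set_val B)) rA'))) rA =
  J *m mean_mx f (J *m set_val A) (J *m set_val B).
  rewrite /bullet /J_pow /J_fun /mean_mx !mulmxA mulJJ mul1mx.
  by rewrite -!(mulmxA _ J J) mulJJ !mulmx1.
split=> h A B; first exact: etrans (h A B) (E A B).
exact: etrans (h A B) (esym (E A B)).
Qed.

Lemma representing_formula (sJ : PJ -> PJ -> PJ) f :
  representing_function (associated_mean sJ) f <->
  normalized_operator_monotone f /\ J_mean_formula sJ f.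
Proof.
rewrite J_mean_formulaE; split=> -[nf h]; split=> // A B.
  have := h (from_PJ A) (from_PJ B).
  rewrite /associated_mean !from_PJK !from_PJ_val => E.
  by rewrite -[LHS]mulJK E.
have := h (to_PJ A) (to_PJ B); rewrite !to_PJ_val !mulJK => E.
by rewrite /associated_mean from_PJ_val E mulJK.
Qed.

Lemma J_mean_formula_unique (sJ sJ' : PJ -> PJ -> PJ) f :
  J_mean_formula sJ f -> J_mean_formula sJ' f -> sJ = sJ'.
Proof.
move=> /J_mean_formulaE h /J_mean_formulaE h'.
apply/funext => A; apply/funext => B; apply: val_inj.
by have := h A B; rewrite -h'.
Qed.

Lemma J_mean_of_formula f : J_mean_formula (J_mean (@mean R k f n)) f.
Proof. by apply/J_mean_formulaE => A B. Qed.

Lemma J_fun_posdef f (X : 'M[D]_n) : PJ X -> PJ (J_fun f X).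
Proof.
move=> [_ /posdefE pX]; have pf := (posdefE _).2 (fun_calc_pd f pX).
exact: (mulJ_J_posdef (SigSub (mem_set pf) : P)).
Qed.

Lemma representing_function_inj (s : P -> P -> P) f g : (0 < n)%N ->
  representing_function s f -> representing_function s g -> f = g.
Proof.
move=> n0 [_ hf] [_ hg]; apply/funext => x.
have p1 : P 1%:M by apply/posdefE; exact: pd1.
have px : P (reals x%:num)%:M.
  by apply/posdefE; rewrite -scalemx1; apply: pdZ => //; exact: pd1.
have := hf (SigSub (mem_set p1)) (SigSub (mem_set px)).
have := hg (SigSub (mem_set p1)) (SigSub (mem_set px)).
move=> /= -> E.
have := etrans (esym (mean1 k f n x)) (etrans (esym E) (mean1 k g n x)).
by move=> /(reals_mx_inj n0) /val_inj.
Qed.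
End transport.

Theorem theorem4p5 (R : realType) (k : scalar_kind) (p q : nat)
    (n_gt0 : (0 < p + q)%N) :
  [/\
      exists Phi : ({posnum R} -> {posnum R}) ->
          (@J_posdef_mx R k p q -> @J_posdef_mx R k p q ->
           @J_posdef_mx R k p q),
        set_bij (@normalized_operator_monotone R)
          (@representable_J_mean R k p q) Phi /\
        (forall f, normalized_operator_monotone f ->
          representing_function (associated_mean (Phi f)) f),
      forall sJ : @J_posdef_mx R k p q -> @J_posdef_mx R k p q ->
          @J_posdef_mx R k p q,
        J_kubo_ando_mean sJ ->
        kubo_ando_mean (associated_mean sJ) /\
        (forall f, representing_function (associated_mean sJ) f ->
          J_mean_formula sJ f) &
      forall f : {posnum R} -> {posnum R},
        normalized_operator_monotone f ->
        (forall X, @J_posdef_mx R k p q X -> @J_posdef_mx R k p q (J_fun f X)) /\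
        (exists! sJ : @J_posdef_mx R k p q -> @J_posdef_mx R k p q ->
            @J_posdef_mx R k p q,
          J_kubo_ando_mean sJ /\ J_mean_formula sJ f)].
Proof.
pose Phi f := J_mean (@mean R k f (p + q)).
have PhiE f : J_mean_formula (Phi f) f := @J_mean_of_formula R k p q f.
have PhiR f : normalized_operator_monotone f ->
    representing_function (associated_mean (Phi f)) f.
  by move=> nf; apply/representing_formula.
have PhiJ f : normalized_operator_monotone f -> J_kubo_ando_mean (Phi f).
  by move=> nf; apply/J_mean_kubo_ando/mean_kubo_ando.
split.
- exists Phi; split=> //; split.
  + by move=> f nf; split; [exact: PhiJ|exists f; exact: PhiR].
  + move=> f g /set_mem nf /set_mem ng E.
    apply: (representing_function_inj n_gt0 (PhiR f nf)); rewrite E; exact: PhiR.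
  + move=> sJ [_ [f /representing_formula[nf h]]]; exists f => //.
    exact: J_mean_formula_unique h.
- move=> sJ hJ; split; first exact: associated_kubo_ando.
  by move=> f /representing_formula[].
- move=> f nf; split; first by move=> X; exact: J_fun_posdef.
  exists (Phi f); split; first by split; [exact: PhiJ|].
  by move=> sJ [_ h]; exact: J_mean_formula_unique h.
Qed.
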